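(* Let $L$ be a link in $\mathbb{R}\mathrm{P}^3$ and let $D$ be a projective diagram of $L$, with the chain groups $C^i(D)$ and total differentials $d^{(i)}:C^i(D)\to C^{i-2}(D)$ constructed below (for any admissible choices of orientations and orderings). Then $d^{(i-2)}\circ d^{(i)}=0$ for every $i$, so $(C^\bullet(D),d)$ is a chain complex.
   Context: Diagrams. Identify $\mathbb{R}\mathrm{P}^3\setminus\{*\}$ with the twisted $I$-bundle $\mathbb{R}\mathrm{P}^2\tilde\times I$ and project links to $\mathbb{R}\mathrm{P}^2$, viewed as a 2-disk with antipodal boundary points identified. Two such (projective) diagrams represent ambient isotopic links iff they are related by the classical Reidemeister moves R-I, R-II, R-III together with two additional moves R-IV, R-V (Drobotukhina's moves acting across the boundary circle of the disk). Let $D$ be an oriented projective diagram with set of crossings $\mathcal{X}$, $|\mathcal{X}|=n$, ordered arbitrarily. Each crossing has a sign $\pm1$ by the right-hand rule. Each crossing can be smoothed in type $0$ (the Kauffman $A$-smoothing, carrying coefficient $A$ in the relation $L_\times=AL_0+A^{-1}L_\infty$) or type $1$ (the $B$-smoothing, coefficient $A^{-1}$). A state is $s\in\{0,1\}^{\mathcal X}$; the corresponding complete smoothing is a disjoint union of circles in $\mathbb{R}\mathrm{P}^2$, each trivial (bounding a disk) or projective (not); each state has at most one projective circle. Let $\#0(s),\#1(s)$ be the numbers of $0$'s and $1$'s in $s$, $|s|_T,|s|_P$ the numbers of trivial and projective circles. Modules. $V=\langle 1,X\rangle$ is the free bigraded $\mathbb{Z}$-module with $\deg 1=(-2,0)$,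 $\deg X=(2,0)$; $\overline V=\langle\bar 1,\bar X\rangle$ with $\deg\bar1=(0,1)$, $\deg\bar X=(0,-1)$. For bigraded modules, $W\wedge W'=\bigoplus_{j=j_1+j_2,k=k_1+k_2}W_{j_1,k_1}\wedge W'_{j_2,k_2}$ (the tensor product of the pieces, with the convention that it is associative and reordering factors of a product $W_1\wedge\cdots\wedge W_n$ by a permutation $\sigma$ multiplies by $\mathrm{sign}(\sigma)$). The shift is $W\{l\}_{j,k}=W_{j-l,k}$. For a state $s$, enumerate its circles with the projective circle (if any) last, and set $C_s=(V_1\wedge\cdots\wedge V_r)\{\#0(s)-\#1(s)\}$ or $C_s=(V_1\wedge\cdots\wedge V_{r}\wedge\overline V_{r+1})\{\#0(s)-\#1(s)\}$, one factor $V$ per trivial circle and $\overline V$ for the projective circle. Put $C^i=\bigoplus_{\#0(s)-\#1(s)=i}C_s$. Partial differentials. Orient every circle of every state arbitrarily. An edge is $\alpha\in\{0,1,\star\}^{\mathcal X}$ with exactly one $\star$, at crossing $c$; $s_0=\alpha_{\star\to0}$, $s_1=\alpha_{\star\to1}$. Passing from $s_0$ to $s_1$ is a bifurcation of type $2\to1$ (two circles merge), $1\to2$ (one circle splits), or $1\to1$ (one circle becomes one circle; possible only because $\mathbb{R}\mathrm{P}^2$ is non-orientable); all other circles correspond bijectively. Position $c$ so that its two outgoing diagram arcs point northwest and northeast and incoming arcs come from southwest and southeast. A circle of a state near $c$ is locally consistent at $c$ if its orientation agrees with the diagram orientation of the northeast arc or disagrees with that of the southwest arc, and locally inconsistent if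 it disagrees with the northeast arc or agrees with the southwest arc. Define $d_\alpha:C_{s_0}\to C_{s_1}$ by $d_\alpha=P_\rho\circ(\varphi\wedge\mathcal I)\circ P_\sigma$, where: $P_\sigma$ permutes wedge factors of $C_{s_0}$ (with sign of the permutation) so that the factors of the circles involved in the bifurcation come first, and for type $2\to1$ the first factor is the left circle if $c$ is positive and the top circle if $c$ is negative; $\varphi=m$ for type $2\to1$, $\varphi=\Delta$ for type $1\to2$ (the first output factor being the top circle if $c$ is positive and the left circle if $c$ is negative), and $\varphi=0$ for type $1\to1$; $\mathcal I$ acts on each remaining factor by $1\mapsto1$, $X\mapsto\pm X$ (resp. $\bar1\mapsto\bar1$, $\bar X\mapsto\pm\bar X$), with $+$ iff the chosen orientations of the corresponding circles in $s_0$ and $s_1$ agree; $P_\rho$ reorders the result into the factor order of $C_{s_1}$. In the formulas for $m,\Delta$, write $X'=\epsilon X$, $\bar X'=\epsilon\bar X$, where $\epsilon=+1$ if the circle carrying that factor is locally consistent at $c$ and $-1$ otherwise (subscripts indicate factor position, unsubscripted is the single circle): $m:V\wedge V\to V$: $1\wedge1\mapsto1$, $1\wedge X'\mapsto X'$, $X'\wedge1\mapsto X'$, $X'\wedge X'\mapsto0$; $\Delta:V\to V\wedge V$: $1\mapsto 1_1\wedge X'_2+X'_1\wedge1_2$, $X'\mapsto X'_1\wedge X'_2$. $m:\overline V\wedge V\to\overline V$: $\bar1\wedge1\mapsto\bar1$, $\bar1\wedge X'\mapsto0$, $\bar X'\wedge1\mapsto\bar X'$, $\bar X'\wedge X'\mapsto0$;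 $\Delta:\overline V\to\overline V\wedge V$: $\bar1\mapsto\bar1_1\wedge X'_2$, $\bar X'\mapsto\bar X'_1\wedge X'_2$. $m:V\wedge\overline V\to\overline V$: $1\wedge\bar1\mapsto\bar1$, $1\wedge\bar X'\mapsto\bar X'$, $X'\wedge\bar1\mapsto0$, $X'\wedge\bar X'\mapsto0$; $\Delta:\overline V\to V\wedge\overline V$: $\bar1\mapsto X'_1\wedge\bar1_2$, $\bar X'\mapsto X'_1\wedge\bar X'_2$. The total differential is $d^{(i)}=\sum d_\alpha:C^i\to C^{i-2}$, summed over all edges $\alpha$ with $\#0(\alpha)-\#1(\alpha)=i-1$. The homology is $H_i(D)=\ker d^{(i)}/\operatorname{im}d^{(i+2)}$, a triply graded $\mathbb{Z}$-module (homological degree $i$ and the bigrading $(j,k)$). *)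

(* Defs.v *)
From HB Require Import structures.
From mathcomp Require Import all_boot all_order all_algebra.
Set Implicit Arguments. Unset Strict Implicit. Unset Printing Implicit Defensive.
Import GRing.Theory Num.Theory.

(* RP^2 is the disk D^2 with antipodal boundary points identified.  A       *)
(* projective diagram in general position is presented as a Morse word: a   *)
(* vertical stack of elementary slices, read bottom (width 0) to top.       *)
(* Between slices there are horizontal "level" lines; level k (k = 0..N)    *)
(* meets the diagram transversally in [wd k] points (k, 0), ..., (k, wd k-1)*)
(* numbered left to right.  The 2m points of the top level lie on the      *)
(* boundary circle of the disk (all on one arc, in cyclic order), and top   *)
(* point j is identified with top point j+m (the antipodal identification, *)
(* up to conjugation by a homeomorphism of the circle).                    *)
(*   Cup i      : width k -> k+2, new minimum joining top points i, i+1;    *)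
(*   Cap i      : width k+2 -> k, maximum joining bottom points i, i+1;     *)
(*   Cross i o  : width k -> k, crossing of the strands through positions   *)
(*                i, i+1; strand A runs bottom i -> top i+1, strand B runs  *)
(*                bottom i+1 -> top i; A is the over strand iff o = true.   *)
(* Every other point passes straight through a slice.                       *)

Inductive slice : Type := Cup of nat | Cap of nat | Cross of nat & bool.

Definition step (k : nat) (s : slice) : nat :=
  match s with Cup _ => k.+2 | Cap _ => k.-2 | Cross _ _ => k end.

Definition is_cross (s : slice) : bool := if s is Cross _ _ then true else false.

Definition pt := (nat * nat)%type.  (* (level, position) *)

(* orientation data on points: true = the curve crosses the level upwards. *)
(* An edge joins two points; it is "vertical" (joins two levels) or        *)
(* "horizontal" (cup/cap/boundary identification: same level).  An         *)
(* orientation is consistent along an edge iff it is preserved along       *)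
(* vertical edges and reversed along horizontal ones.                      *)
Definition orient_ok (E : seq (pt * pt)) (o : pt -> bool) : bool :=
  all (fun ed => (o ed.1 == o ed.2) == (ed.1.1 != ed.2.1)) E.

Fixpoint ninv (l : seq nat) : nat :=
  match l with [::] => 0 | a :: l' => count (fun b => b < a) l' + ninv l' end.
Definition sgn (l : seq nat) : int := ((-1) ^+ ninv l)%R.

Section Diagram.
Variable w : seq slice.
Local Notation N := (size w).

Definition sl (k : nat) : slice := nth (Cup 0) w k.
Definition wd (k : nat) : nat := foldl step 0 (take k w).

Definition slice_ok (k : nat) : bool :=
  match sl k with
  | Cup i => i <= wd k
  | Cap i => i.+1 < wd k
  | Cross i _ => i.+1 < wd k
  end.

Definition wf : bool := all slice_ok (iota 0 N) && ~~ odd (wd N).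

Definition hm : nat := (wd N)./2.

Definition cross_i (k : nat) : nat := if sl k is Cross i _ then i else 0.
Definition cross_o (k : nat) : bool := if sl k is Cross _ o then o else false.

Definition crossing := {k : 'I_N | is_cross (sl k)}.
Definition cidx (c : crossing) : nat := val (val c).
(* states: 0 = Kauffman A-smoothing, 1 = B-smoothing *)
Definition state := {ffun crossing -> bool}.

(* nodes: points on level lines (only valid ones lie on the diagram) *)
Definition node := ('I_N.+1 * 'I_(2 * N).+1)%type.
Definition np (v : node) : pt := (val v.1, val v.2).
Definition nd (p : pt) : node := (inord p.1, inord p.2).
Definition dn : node := (ord0, ord0).
Definition valid_node (v : node) : bool := val v.2 < wd (val v.1).

(* local connections inside a crossing slice:
   None        : the two strands of the link (A and B);
   Some true   : vertical smoothing (bottom i - top i, bottom i+1 - top i+1);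
   Some false  : horizontal smoothing (bottom i - bottom i+1, top i - top i+1). *)
Definition cross_conn (k i : nat) (m : option bool) : seq (pt * pt) :=
  match m with
  | None => [:: ((k, i), (k.+1, i.+1)); ((k, i.+1), (k.+1, i))]
  | Some true => [:: ((k, i), (k.+1, i)); ((k, i.+1), (k.+1, i.+1))]
  | Some false => [:: ((k, i), (k, i.+1)); ((k.+1, i), (k.+1, i.+1))]
  end.

Definition slice_edges (k : nat) (m : option bool) : seq (pt * pt) :=
  match sl k with
  | Cup i => ((k.+1, i), (k.+1, i.+1)) ::
             [seq ((k, p), (k.+1, if p < i then p else p.+2)) | p <- iota 0 (wd k)]
  | Cap i => ((k, i), (k, i.+1)) ::
             [seq ((k, p), (k.+1, if p < i then p else p - 2))
               | p <- iota 0 (wd k) & (p != i) && (p != i.+1)]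
  | Cross i _ => cross_conn k i m ++
             [seq ((k, p), (k.+1, p)) | p <- iota 0 (wd k) & (p != i) && (p != i.+1)]
  end.

Definition glue_edges : seq (pt * pt) := [seq ((N, j), (N, j + hm)) | j <- iota 0 hm].

Definition edges_with (m : nat -> option bool) : seq (pt * pt) :=
  flatten [seq slice_edges k (m k) | k <- iota 0 N] ++ glue_edges.

Definition link_edges : seq (pt * pt) := edges_with (fun _ => None).

Definition bit (s : state) (k : nat) : bool := [exists c : crossing, (cidx c == k) && s c].

(* Kauffman A-smoothing: rotating the over strand counterclockwise sweeps the
   A-regions; with A (bottom i -> top i+1, slope +1) over, these are the top
   and bottom regions, so the A-smoothing (0) is the vertical one; with B over
   it is the horizontal one.  The B-smoothing (1) is the other one. *)
Definition smode (s : state) (k : nat) : option bool := Some (cross_o k != bit s k).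

Definition state_edges (s : state) : seq (pt * pt) := edges_with (smode s).

Definition adj (s : state) : rel node :=
  fun u v => ((np u, np v) \in state_edges s) || ((np v, np u) \in state_edges s).

Definition circ (s : state) (r v : node) : bool := connect (adj s) r v.

(* a circle is projective iff it crosses the boundary line an odd number of times *)
Definition proj (s : state) (r : node) : bool :=
  odd (count (fun j => circ s r (nd (N, j))) (iota 0 hm)).

(* an enumeration of the circles of s by representatives, projective one last *)
Definition enum_ok (s : state) (r : seq node) : Prop :=
  [/\ all valid_node r,
      pairwise (fun a b => ~~ circ s a b) r,
      (forall v, valid_node v -> has (fun a => circ s a v) r) &
      (forall j, j.+1 < size r -> ~~ proj s (nth dn r j))].

Definition grade (s : state) : int :=
  (#|[set c | ~~ s c]|%:Z - #|[set c | s c]|%:Z)%R.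

Definition upd (s : state) (c : crossing) (b : bool) : state :=
  [ffun c' => if c' == c then b else s c'].

Section Complex.
(* dir : the orientation of the link (consistent with link_edges);
   e   : for each state, the chosen enumeration of its circles;
   o   : for each state, the chosen orientations of its circles. *)
Variable dir : pt -> bool.
Variable e : state -> seq node.
Variable o : state -> pt -> bool.

(* basis of C_s: labels 1 (false) / X (true) on the wedge factors, in order *)
Definition basis (s : state) := {ffun 'I_(size (e s)) -> bool}.
(* an element of the direct sum of all C_s *)
Definition Chain := forall s : state, basis s -> int.

Definition lab (r : nat) (x : {ffun 'I_r -> bool}) (j : nat) : bool :=
  if (insub j : option 'I_r) is Some j' then x j' else false.

(* Chart at a crossing: rotate so that the outgoing arcs point NW and NE. *)
Section Chart.
Variable c : crossing.
Let k := cidx c.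
Let i := cross_i k.
Let dA := dir (k, i).
Let dB := dir (k, i.+1).
Definition NW : pt := match dA, dB with
  | true, true => (k.+1, i) | false, false => (k, i.+1)
  | true, false => (k.+1, i.+1) | false, true => (k, i) end.
Definition NE : pt := match dA, dB with
  | true, true => (k.+1, i.+1) | false, false => (k, i)
  | true, false => (k, i.+1) | false, true => (k.+1, i) end.
Definition SW : pt := match dA, dB with
  | true, true => (k, i) | false, false => (k.+1, i.+1)
  | true, false => (k.+1, i) | false, true => (k, i.+1) end.
Definition SE : pt := match dA, dB with
  | true, true => (k, i.+1) | false, false => (k.+1, i)
  | true, false => (k, i) | false, true => (k.+1, i.+1) end.
(* right-hand rule: sign of (over direction) x (under direction) *)
Definition vecA : int * int := if dA then (1, 1)%R else (-1, -1)%R.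
Definition vecB : int * int := if dB then (-1, 1)%R else (1, -1)%R.
Definition crossz (u v : int * int) : int := (u.1 * v.2 - u.2 * v.1)%R.
Definition positive : bool :=
  if cross_o k then (0 < crossz vecA vecB)%R else (0 < crossz vecB vecA)%R.
(* a point of the left arc (NW-SW) and of the top arc (NW-NE) *)
Definition left_pt : pt := NW.
Definition top_pt : pt := NW.
End Chart.

Definition pos (s : state) (v : pt) : nat := find (fun r => circ s r (nd v)) (e s).
Definition rep (s : state) (j : nat) : node := nth dn (e s) j.

Definition eps (c : crossing) (s : state) (j : nat) : int :=
  let C := circ s (rep s j) in
  if (C (nd (NE c)) && (o s (NE c) == dir (NE c)))
     || (C (nd (SW c)) && (o s (SW c) != dir (SW c))) then 1%R else (-1)%R.

Definition fac (a : bool) (ep : int) : int := if a then ep else 1%R.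

(* structure constants of m and Delta in the X' basis (1 or 0);
   p1/p2 : first/second factor projective *)
Definition mcoef (p1 p2 a1 a2 b : bool) : bool :=
  if p1 then ~~ a2 && (b == a1)           (* Vbar ^ V -> Vbar *)
  else if p2 then ~~ a1 && (b == a2)      (* V ^ Vbar -> Vbar *)
  else ~~ (a1 && a2) && (b == a1 || a2).  (* V ^ V -> V *)
Definition dcoef (q1 q2 a b1 b2 : bool) : bool :=
  if q1 then b2 && (b1 == a)              (* Vbar -> Vbar ^ V *)
  else if q2 then b1 && (b2 == a)         (* Vbar -> V ^ Vbar *)
  else if a then b1 && b2 else b1 != b2.  (* V -> V ^ V *)

(* matrix coefficient <y, d_alpha x> for the edge alpha with star at c,
   s0 = alpha(star -> 0), s1 = alpha(star -> 1) *)
Definition coef (c : crossing) (s0 s1 : state) (x : basis s0) (y : basis s1) : int :=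
  let corners := [:: NW c; NE c; SW c; SE c] in
  let inv0 := undup [seq pos s0 v | v <- corners] in
  let inv1 := undup [seq pos s1 v | v <- corners] in
  let first0 := pos s0 (if positive c then left_pt c else top_pt c) in
  let first1 := pos s1 (if positive c then top_pt c else left_pt c) in
  let other0 := head first0 [seq p <- inv0 | p != first0] in
  let other1 := head first1 [seq p <- inv1 | p != first1] in
  let I0 := if size inv0 == 2 then [:: first0; other0] else [:: first0] in
  let O1 := if size inv1 == 2 then [:: first1; other1] else [:: first1] in
  let R0 := [seq j <- iota 0 (size (e s0)) | j \notin inv0] in
  let tau j := pos s1 (np (rep s0 j)) in
  let agree j := [forall v : node, circ s0 (rep s0 j) v ==> (o s0 (np v) == o s1 (np v))] in
  let Isign := (\prod_(j <- R0 | lab x j) (if agree j then 1 else -1))%R in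
  let phi : int :=
    if (size inv0 == 2) && (size inv1 == 1) then
      if mcoef (proj s0 (rep s0 first0)) (proj s0 (rep s0 other0))
               (lab x first0) (lab x other0) (lab y first1)
      then (fac (lab x first0) (eps c s0 first0) * fac (lab x other0) (eps c s0 other0)
            * fac (lab y first1) (eps c s1 first1))%R
      else 0%R
    else if (size inv0 == 1) && (size inv1 == 2) then
      if dcoef (proj s1 (rep s1 first1)) (proj s1 (rep s1 other1))
               (lab x first0) (lab y first1) (lab y other1)
      then (fac (lab x first0) (eps c s0 first0) * fac (lab y first1) (eps c s1 first1)
            * fac (lab y other1) (eps c s1 other1))%R
      else 0%R
    else 0%R (* type 1 -> 1 : phi = 0 *) in
  if all (fun j => lab y (tau j) == lab x j) R0
  then (sgn (I0 ++ R0) * sgn (O1 ++ map tau R0) * Isign * phi)%R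
  else 0%R.

(* the total differential d^(i) : C^i -> C^(i-2), as a map on the direct sum
   reading only the C^i components *)
Definition dtot (i : int) (f : Chain) : Chain := fun s1 y =>
  (\sum_(c : crossing | s1 c)
     (if grade (upd s1 c false) == i then
        \sum_(x : basis (upd s1 c false)) f (upd s1 c false) x * coef c x y
      else 0))%R.

End Complex.
End Diagram.

(* Main.v *)
(* Fix a square face of the cube of states, at two crossings.  Cutting both crossings open
   leaves circles that the face does not touch and four arcs joining the eight corners.
   The arcs are obtained by walking along darts (a point together with a side): the
   involutions "switch side" and "follow the edge" generate dihedral orbits, and an orbit
   through a cut corner contains exactly one other cut corner.  Hence the face is described
   by a perfect matching of eight labels together with the parity with which each arc meets
   the boundary circle.

   Label the corners of a crossing 0, 1, 2, 3 so that 0 is the north-west corner, 3 the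
   south-east one, and the 0-smoothing joins 0-1 and 2-3 while the 1-smoothing joins 0-2 and
   1-3.  The first circle of a bifurcation is then always the one through 0, for both signs
   of the crossing, and a circle is locally consistent iff it leaves the crossing at 1 or 2.

   A matrix coefficient of a partial differential is the product of one sign for each of the
   two states (orientations of the circles, order of the wedge factors), which cancel around
   the face, and of a coefficient that depends only on the matching and the parities.  So
   anticommutativity of the face is a finite verification over the 105 matchings and 16
   parities.  The only topological input is that no state has two projective circles; no
   planarity is needed. *)
Require Import Defs.
From HB Require Import structures.
From mathcomp Require Import all_boot all_order all_algebra.
From mathcomp Require Import zify ring.
Set Implicit Arguments. Unset Strict Implicit. Unset Printing Implicit Defensive.
Import GRing.Theory Num.Theory.

(** * The finite verification *)

Definition smooth4 (b : bool) (l : nat) : nat :=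
  nth 0 (if b then [:: 2; 3; 0; 1] else [:: 1; 0; 3; 2]) l.
Definition smooth (b1 b2 : bool) (l : nat) : nat :=
  if l < 4 then smooth4 b1 l else 4 + smooth4 b2 (l - 4).

(** The walk alternately follows an arc and a smoothing. Eight labels lie on four arcs, so four
    rounds go all the way around; on a shorter circle the walk repeats, harmlessly since [index]
    finds the first occurrence. *)
Definition cyc (m : seq nat) (b1 b2 : bool) (l : nat) : seq nat :=
  flatten [seq [:: x; nth 0 m x] | x <- traject (fun x => smooth b1 b2 (nth 0 m x)) l 4].
Definition root8 m b1 b2 l := foldr minn l (cyc m b1 b2 l).

(* State of a face: for each label, the least label on its circle ([lroot]) and the parity of
   the walk from there ([lpar]); the list of these least labels, one per circle ([lT]); and
   whether the circle they name is projective ([lproj]). *)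
Record lstate := LState {
  lroot : seq nat; lpar : bitseq; lT : seq nat; lproj : bitseq }.

Definition rt A l := nth 0 (lroot A) l.

(** The condition [l < nth 0 m l] counts each arc once, at its smaller end; the parities of the arcs
    of a circle add up to its projectivity. *)
Definition mk_lstate (m : seq nat) (q : bitseq) (b1 b2 : bool) : lstate :=
  let ro := [seq root8 m b1 b2 l | l <- iota 0 8] in
  LState ro
    [seq odd (index l (cyc m b1 b2 (nth 0 ro l))) | l <- iota 0 8]
    [seq r <- iota 0 8 | nth 0 ro r == r]
    [seq odd (count (fun l => [&& nth 0 ro l == r, l < nth 0 m l & nth false q l]) (iota 0 8))
       | r <- iota 0 8].

Definition llab A (X : bitseq) l := nth false X (index (rt A l) (lT A)).

(** Consistency sign for the reference orientation, which points out of the crossing at the least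
    label of the circle: it then leaves at exactly the labels with [lpar] false. *)
Definition leps A off r : int :=
  if ((rt A (off + 1) == r) && ~~ nth false (lpar A) (off + 1))
  || ((rt A (off + 2) == r) && ~~ nth false (lpar A) (off + 2)) then 1%R else (-1)%R.

Definition pair2 (a b : nat) := if a == b then [:: a] else [:: a; b].

Definition sg (b : bool) : int := (if b then -1 else 1)%R.

(** Coefficient of the edge when circles are ordered as in [lT] and carry the reference orientation.
    A circle [r] away from the crossing acquires a sign exactly when its reference orientation in
    [B] enters at [r]. *)
Definition lcoef off A B X Y : int :=
  let a0 := rt A off in let a3 := rt A (off + 3) in
  let b0 := rt B off in let b3 := rt B (off + 3) in
  let R := [seq r <- lT A | r \notin pair2 a0 a3] in
  if all (fun r => llab B Y r == llab A X r) R then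
   (sgn (pair2 a0 a3 ++ R) * sgn (lT A) * (sgn (pair2 b0 b3 ++ map (rt B) R) * sgn (lT B))
    * foldr *%R 1 [seq (if llab A X r then sg (nth false (lpar B) r) else 1) | r <- R]
    * (if (a0 != a3) && (b0 == b3) then
         if mcoef (nth false (lproj A) a0) (nth false (lproj A) a3)
                  (llab A X off) (llab A X (off + 3)) (llab B Y off)
         then fac (llab A X off) (leps A off a0) * fac (llab A X (off + 3)) (leps A off a3)
              * fac (llab B Y off) (leps B off b0)
         else 0
       else if (a0 == a3) && (b0 != b3) then
         if dcoef (nth false (lproj B) b0) (nth false (lproj B) b3)
                  (llab A X off) (llab B Y off) (llab B Y (off + 3))
         then fac (llab A X off) (leps A off a0) * fac (llab B Y off) (leps B off b0)
              * fac (llab B Y (off + 3)) (leps B off b3)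
         else 0
       else 0))%R
  else 0%R.

Fixpoint bitseqs n : seq bitseq :=
  if n is n'.+1 then map (cons false) (bitseqs n') ++ map (cons true) (bitseqs n')
  else [:: [::]].

Definition lpath off off' A B C X Y : int :=
  foldr +%R 0%R [seq (lcoef off A B X Z * lcoef off' B C Z Y)%R | Z <- bitseqs (size (lT B))].

Definition one_proj A := count (nth false (lproj A)) (lT A) <= 1.

Definition ok_lstate (m : seq nat) b1 b2 A :=
  all (fun l => [&& rt A l < 8, rt A (rt A l) == rt A l, rt A (nth 0 m l) == rt A l,
        rt A (smooth b1 b2 l) == rt A l & l \in cyc m b1 b2 (rt A l)]) (iota 0 8).

(** Reversing a circle negates its consistency sign only if it meets label 1 or 2 and, when it meets
    both, enters at both or leaves at both. *)
Definition eps_ok off A r :=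
  let b1 := rt A (off + 1) == r in let b2 := rt A (off + 2) == r in
  (b1 || b2) && (b1 && b2 ==> (nth false (lpar A) (off + 1) == nth false (lpar A) (off + 2))).

(** Coherence of signs is demanded only when the number of circles changes. In type 1 to 1 the
    circle leaves at one of the labels 1, 2 and enters at the other, but there the coefficient is
    0. *)
Definition ok_edge off A B :=
  let a0 := rt A off in let a3 := rt A (off + 3) in
  let b0 := rt B off in let b3 := rt B (off + 3) in
  let R := [seq r <- lT A | r \notin pair2 a0 a3] in
  [&& perm_eq (lT A) (pair2 a0 a3 ++ R), perm_eq (lT B) (pair2 b0 b3 ++ map (rt B) R) &
    ((a0 == a3) != (b0 == b3)) ==>
    [&& eps_ok off A a0, eps_ok off A a3, eps_ok off B b0 & eps_ok off B b3]].

Definition ok_square (m : seq nat) (A : bool -> bool -> lstate) :=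
  let A00 := A false false in let A10 := A true false in
  let A01 := A false true in let A11 := A true true in
  [&& ok_lstate m false false A00, ok_lstate m true false A10,
      ok_lstate m false true A01, ok_lstate m true true A11,
      ok_edge 0 A00 A10, ok_edge 0 A01 A11, ok_edge 4 A00 A01, ok_edge 4 A10 A11 &
      if [&& one_proj A00, one_proj A10, one_proj A01 & one_proj A11] then
      all (fun X => all (fun Y =>
        (lpath 0 4 A00 A10 A11 X Y + lpath 4 0 A00 A01 A11 X Y == 0)%R)
        (bitseqs (size (lT A11)))) (bitseqs (size (lT A00))) else true].

Definition ok_face m q := ok_square m (mk_lstate m q).

(** Matchings are grown entry by entry and a prefix is discarded at its first conflict, which avoids
    listing all [8 ^ 8] tables. *)
Definition ok_prefix (p : seq nat) :=
  uniq p && all (fun i => (nth 0 p i != i) &&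
    ((nth 0 p i < size p) ==> (nth 0 p (nth 0 p i) == i))) (iota 0 (size p)).

Fixpoint prefixes n : seq (seq nat) :=
  if n is n'.+1
  then [seq p <- [seq rcons p v | p <- prefixes n', v <- iota 0 8] | ok_prefix p]
  else [:: [::]].

Definition ok_all :=
  all (fun m => all (fun q =>
     if all (fun l => nth false q (nth 0 m l) == nth false q l) (iota 0 8)
     then ok_face m q else true)
     (bitseqs 8)) (prefixes 8).

Lemma ok_allT : ok_all.
Proof. by vm_compute. Qed.

Lemma mem_bitseqs n (s : bitseq) : (s \in bitseqs n) = (size s == n).
Proof.
have consI (b : bool) : injective (cons b) by move=> ? ? [].
have consN b b' (s' : bitseq) l : b' != b -> (b :: s' \in map (cons b') l) = false.
  by move=> /negP nb; apply/mapP=> -[s'' _ [E]]; case: nb; rewrite E.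
elim: n s => [|n IH] [|b s] //=; rewrite mem_cat.
  by apply/norP; split; apply/mapP=> -[].
rewrite eqSS -IH; case: b.
  by rewrite consN // (mem_map (consI true)).
by rewrite (mem_map (consI false)) [X in _ || X]consN // orbF.
Qed.

Lemma bitseqs_uniq n : uniq (bitseqs n).
Proof.
elim: n => [//|n IH] /=; rewrite cat_uniq !map_inj_uniq ?IH //; try by move=> ? ? [].
by rewrite andbT; apply/hasPn=> s /mapP[s' _ ->]; apply/mapP=> -[].
Qed.

(** Every initial segment of a fixed-point-free involution passes the test, because [ok_prefix]
    checks the image of an image only when it falls inside the segment. *)
Lemma prefixes_complete (m : seq nat) :
    size m = 8 -> uniq m -> (forall l, l < 8 ->
      [/\ nth 0 m l < 8, nth 0 m l != l & nth 0 m (nth 0 m l) = l]) ->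
  m \in prefixes 8.
Proof.
move=> szm um mP.
suff: forall n, n <= 8 -> take n m \in prefixes n.
  by move/(_ 8 isT); rewrite take_oversize ?szm.
elim=> [|n IH] ltn8; first by rewrite take0.
have szt : size (take n.+1 m) = n.+1 by rewrite size_takel // szm.
rewrite mem_filter; apply/andP; split.
  rewrite /ok_prefix take_uniq //= szt.
  apply/allP=> i; rewrite mem_iota add0n => /= lti.
  have [_ mN mK] := mP i (leq_trans lti ltn8).
  rewrite nth_take // mN /=; apply/implyP => ltm.
  by rewrite nth_take // mK.
rewrite (take_nth 0) ?szm //; apply/allpairsP.
exists (take n m, nth 0 m n); split=> //; first by apply: IH; apply: ltnW.
by rewrite mem_iota /=; case: (mP n ltn8).
Qed.

Lemma ok_squareP m (A : bool -> bool -> lstate) : ok_square m A ->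
  [/\ forall b1 b2, ok_lstate m b1 b2 (A b1 b2),
      forall b, ok_edge 0 (A false b) (A true b),
      forall b, ok_edge 4 (A b false) (A b true) &
      (forall b1 b2, one_proj (A b1 b2)) -> forall X Y,
        size X = size (lT (A false false)) -> size Y = size (lT (A true true)) ->
      (lpath 0 4 (A false false) (A true false) (A true true) X Y
       + lpath 4 0 (A false false) (A false true) (A true true) X Y = 0)%R].
Proof.
rewrite /ok_square => /andP[l00 /andP[l10 /andP[l01 /andP[l11 /andP[e1 /andP[e2 /andP[e3 /andP[e4 fc]]]]]]]].
split; [by case=> -[] | by case | by case |].
move=> op X Y sX sY; move: fc; rewrite !op => /allP/(_ X).
rewrite mem_bitseqs sX eqxx => /(_ isT)/allP/(_ Y).
by rewrite mem_bitseqs sY eqxx => /(_ isT)/eqP.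
Qed.

Lemma ok_faceT m q : m \in prefixes 8 -> size q = 8 ->
  (forall l, l < 8 -> nth false q (nth 0 m l) = nth false q l) -> ok_face m q.
Proof.
move=> mP sq qm; have /allP/(_ m mP)/allP/(_ q) := ok_allT.
rewrite mem_bitseqs sq eqxx => /(_ isT).
suff -> : all (fun l => nth false q (nth 0 m l) == nth false q l) (iota 0 8) by exact: id.
by apply/allP=> l; rewrite mem_iota => /= l8; rewrite qm.
Qed.

(** * Signs of orderings and dihedral orbits *)

Lemma sgn_cons a l :
  sgn (a :: l) = ((-1) ^+ count (fun b => (b < a)%N) l * sgn l)%R.
Proof. by rewrite /sgn /= exprD. Qed.

Lemma sgn_sqr l : (sgn l * sgn l = 1)%R.
Proof. by rewrite /sgn -expr2 sqrr_sign. Qed.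

(** Only the comparison of [a] with [b] changes, and exactly one of the two orders is an
    inversion. *)
Lemma sgn_swap u a b v : a != b ->
  sgn (u ++ [:: a, b & v]) = (- sgn (u ++ [:: b, a & v]))%R.
Proof.
move=> neq_ab; elim: u => [|c u IH] /=.
  rewrite /sgn /= !addnA; have: (b < a) + (a < b) = 1.
    by case: ltngtP neq_ab.
  case: (b < a); case: (a < b) => // _ /=;
    rewrite ?add1n ?addn0 ?add0n exprD exprD [in RHS]exprD;
    rewrite ?addSn ?exprS ?exprD; ring.
rewrite !sgn_cons IH mulrN; congr (- (_ ^+ _ * _))%R.
by rewrite !count_cat /= [_ + (_ + count _ v)]addnCA.
Qed.

(** Adjacent transpositions generate all permutations. The domain [D] confines the hypothesis to
    entries of the list, the only place where the maps used below are injective. *)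
Lemma eq_perm_swaps (T : eqType) (R : Type) (D : {pred T}) (K : seq T -> R) l l' :
    (forall u a b v, a \in D -> b \in D -> a != b ->
      K (u ++ [:: a, b & v]) = K (u ++ [:: b, a & v])) ->
  {subset l <= D} -> uniq l -> perm_eq l l' -> K l = K l'.
Proof.
elim: l l' K => [|a l IH] l' K Kswap lD ul eql.
  by move: (perm_size eql); case: l' {eql}.
have al' : a \in l' by rewrite -(perm_mem eql) mem_head.
have l'D : {subset l' <= D} by move=> x; rewrite -(perm_mem eql); apply: lD.
have ul' : uniq l' by rewrite -(perm_uniq eql).
case/splitPr: al' => p q in eql l'D ul' *.
have eqpq : perm_eq l (p ++ q).
  by rewrite -(perm_cons a) (perm_trans eql) // -cat1s perm_catCA.
(* The head of the first list is carried to the front of the second one by adjacent swaps. *)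
have {1}-> : K (p ++ a :: q) = K (a :: p ++ q).
  elim/last_ind: p q l'D ul' {eqpq eql} => [//|p b IHp] q l'D ul'.
  rewrite -cats1 -!catA /= Kswap.
  - rewrite IHp //.
    + move=> x xpq; apply: l'D; move: xpq.
      rewrite -cats1 -catA !mem_cat !inE.
      by case/or4P=> ->; rewrite ?orbT.
    + rewrite -(perm_uniq (s1 := rcons p b ++ a :: q)) //.
      by rewrite -cats1 -catA perm_cat2l /= (perm_catCA [:: b] [:: a] q).
  - by apply: l'D; rewrite mem_cat mem_rcons mem_head.
  - by apply: l'D; rewrite mem_cat mem_head orbT.
  - move: ul'; rewrite cat_uniq => /and3P[_ /hasPn/(_ a (mem_head _ _)) + _].
    by rewrite mem_rcons inE negb_or eq_sym => /andP[].
apply: (IH (p ++ q) (fun s => K (a :: s))) => //.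
- by move=> u x y v xD yD nxy; rewrite -!cat_cons Kswap.
- by move=> x xl; apply: lD; rewrite inE xl orbT.
- by case/andP: ul.
Qed.

(** A swap changes both signs, so their product does not depend on the order in which the uninvolved
    circles are listed. *)
Lemma sgn_map_perm (T : eqType) (f g : T -> nat) u u' w w' l l' :
    uniq l -> perm_eq l l' -> {in l &, injective f} -> {in l &, injective g} ->
  (sgn (u ++ map f l ++ w) * sgn (u' ++ map g l ++ w') =
   sgn (u ++ map f l' ++ w) * sgn (u' ++ map g l' ++ w'))%R.
Proof.
move=> ul eql injf injg.
apply: (@eq_perm_swaps _ _ (mem l) (fun l => _ * _)%R) => // p a b q al bl neq_ab.
rewrite !map_cat /= -!catA /= catA [in sgn (u' ++ _)]catA.
rewrite [in RHS]catA [in sgn (u' ++ map g p ++ _ :: _)]catA.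
rewrite sgn_swap ?(inj_in_eq injf) // (sgn_swap _ (a := g a)) ?(inj_in_eq injg) //.
by rewrite mulrNN.
Qed.

Section Dihedral.
Variables (T : finType) (a b : T -> T).
Hypotheses (aK : involutive a) (bK : involutive b) (aN : forall x, a x != x).

Definition dstep : rel T := fun x y => (y == a x) || (y == b x).

(** Put [g = b a]. The orbit of [x] is its [g]-cycle, of length [p], on which [a] and [b] act as the
    reflections [n -> p - 1 - n] and [n -> - n] of the indices. Since [a] fixes nothing, [p] is
    even, and the other fixed point of [b] lies opposite to [x]. *)
Lemma dihedral_pair x : b x = x ->
  exists y, [/\ y != x, b y = y, connect dstep x y,
    forall z, connect dstep x z -> b z = z -> z = x \/ z = y &
    forall h : T -> bool, (forall d, h (a d) = ~~ h d) ->
      (forall d, b d != d -> h (b d) = ~~ h d) -> h y = ~~ h x].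
Proof.
move=> bx; pose g d := b (a d).
have ginj : injective g by move=> ? ? /(inv_inj bK)/(inv_inj aK).
set p := order g x; have p_gt0 : 0 < p by apply: order_gt0.
have gp : iter p g x = x by apply: iter_order.
have g_eq i j : i < p -> j < p -> iter i g x = iter j g x -> i = j.
  move=> ip jp eqij.
  by rewrite -(findex_iter ip) -(findex_iter jp) eqij.
have ag n : n < p -> a (iter n g x) = iter (p - n.+1) g x.
  elim: n => [|n IH] np.
    by apply: ginj; rewrite -[RHS]iterS subn1 prednK // gp /g aK.
  apply: ginj; rewrite -[RHS]iterS -subSn // subSS -IH 1?ltnW //.
  by rewrite /g aK bK.
have bg n : 0 < n < p -> b (iter n g x) = iter (p - n) g x.
  by case: n => // n /andP[_ np]; rewrite iterS /g bK ag 1?ltnW.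
(* For odd [p] the reflection [a] would fix the middle index [p./2]. *)
have p_even : ~~ odd p.
  apply/negP=> op; have := aN (iter p./2 g x).
  have lt2 : p./2 < p by rewrite ltn_half_double -addnn -{1}[p]add0n ltn_add2r.
  rewrite ag // eq_sym -{2}(odd_double_half p) op add1n subSS -addnn addnK.
  by rewrite eqxx.
have pE : p = p./2 + p./2 by rewrite addnn even_halfK.
have h_gt0 : 0 < p./2 by move: p_gt0; rewrite {1}pE addn_gt0 orbb.
have h_lt : p./2 < p by rewrite {2}pE -{1}[p./2]add0n ltn_add2r.
have conng n : connect dstep x (iter n g x).
  elim: n => [//|n IH]; apply: connect_trans IH _.
  apply: (@connect_trans _ _ (a (iter n g x))); apply: connect1;
    by rewrite /dstep eqxx ?orbT.
exists (iter p./2 g x); split=> //.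
- apply/eqP=> /(g_eq _ 0 h_lt p_gt0) E; by rewrite E in h_gt0.
- by rewrite bg ?h_gt0 // {1}pE addnK.
- move=> z /connectP[q qP ->] {z}.
  have [n np ->] : exists2 n, n < p & last x q = iter n g x.
    elim/last_ind: q qP => [|q y IH]; first by exists 0.
    rewrite rcons_path last_rcons => /andP[/IH[n np ->] /orP[]/eqP->].
      by exists (p - n.+1); rewrite ?ag // ltn_subrL.
    case: n np => [|n] np; first by exists 0.
    by exists (p - n.+1); rewrite ?bg // ltn_subrL.
  case: n np => [|n] np bn; [by left|right]; move: bn; rewrite bg //.
  move/g_eq; rewrite ltn_subrL => /(_ p_gt0 np) E.
  by congr (iter _ g x); rewrite -[LHS]doubleK -addnn -{1}E subnK 1?ltnW.
(* Before the half-way point each [g] negates [h] twice; the opposite point is then reached by one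
   more application of [a]. *)
move=> h ha hb.
have hg n : n < p./2 -> h (iter n g x) = h x.
  elim: n => [//|n IH] np; have np' : n < p./2 by apply: ltnW.
  rewrite iterS /g hb ?ha ?negbK ?IH //.
  have np2 : n < p by apply: ltn_trans h_lt.
  have E0 : 0 < p - n.+1 by rewrite subn_gt0 (ltn_trans np).
  rewrite ag // bg ?E0 ?ltn_subrL //; apply/eqP => /g_eq.
  rewrite !ltn_subrL E0 p_gt0 => /(_ isT isT).
  by move: np pE; clearbody p; lia.
have {1}-> : iter p./2 g x = a (iter (p./2).-1 g x).
  rewrite ag; last by rewrite prednK // ltnW.
  by rewrite prednK // {2}pE addnK.
by rewrite ha hg ?prednK.
Qed.
End Dihedral.

(** * Darts of a smoothed diagram *)

Section Mates.
Variable w : seq slice.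
Local Notation N := (size w).
Local Notation sl := (sl w).
Local Notation wd := (wd w).
Local Notation hm := (hm w).

Local Arguments Defs.sl : simpl never.
Local Arguments Defs.wd : simpl never.
Local Arguments Defs.hm : simpl never.

(** A dart is a point with a side, [true] meaning above; its mate is the dart at the other end of
    the edge on that side. [m] tells which crossings are smoothed vertically. Above the top level
    lies the antipodal identification. *)
Definition up_mate (m : nat -> bool) (k p : nat) : pt * bool :=
  if k == N then ((k, if p < hm then p + hm else p - hm), true)
  else match sl k with
  | Cup i => ((k.+1, if p < i then p else p.+2), false)
  | Cap i =>
    if p == i then ((k, i.+1), true) else if p == i.+1 then ((k, i), true)
    else ((k.+1, if p < i then p else p - 2), false)
  | Cross i _ =>
    if p == i then if m k then ((k.+1, i), false) else ((k, i.+1), true)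
    else if p == i.+1 then if m k then ((k.+1, i.+1), false) else ((k, i), true)
    else ((k.+1, p), false)
  end.

(** Here [k] is the index of the slice below, so the point itself is on level [k.+1]. *)
Definition down_mate (m : nat -> bool) (k p : nat) : pt * bool :=
  match sl k with
  | Cup i =>
    if p == i then ((k.+1, i.+1), false) else if p == i.+1 then ((k.+1, i), false)
    else ((k, if p < i then p else p - 2), true)
  | Cap i => ((k, if p < i then p else p.+2), true)
  | Cross i _ =>
    if p == i then if m k then ((k, i), true) else ((k.+1, i.+1), false)
    else if p == i.+1 then if m k then ((k, i.+1), true) else ((k.+1, i), false)
    else ((k, p), true)
  end.

Definition mate (m : nat -> bool) (d : pt * bool) : pt * bool :=
  if d.2 then up_mate m d.1.1 d.1.2 else down_mate m d.1.1.-1 d.1.2.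

Definition vpt (p : pt) : bool := (p.1 <= N) && (p.2 < wd p.1).

Hypothesis wfw : wf w.

Lemma wdS k : k < N -> wd k.+1 = step (wd k) (sl k).
Proof. by move=> kN; rewrite /Defs.wd (take_nth (Cup 0)) // foldl_rcons. Qed.

Lemma wd0 : wd 0 = 0. Proof. by rewrite /Defs.wd take0. Qed.

Lemma slice_wf k : k < N -> slice_ok w k.
Proof. by case/andP: wfw => /allP + _ kN; apply; rewrite mem_iota. Qed.

Lemma wdN : wd N = hm + hm.
Proof. by case/andP: wfw => _ ev; rewrite addnn even_halfK. Qed.

(** A slice adds at most two points, so positions fit the ordinal bound in [node] and [inord] loses
    nothing. *)
Lemma wd_le k : k <= N -> wd k <= 2 * k.
Proof.
elim: k => [|k IH] kN; first by rewrite wd0.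
rewrite wdS //; move: (IH (ltnW kN)); case: (sl k) => //= *; lia.
Qed.

Lemma vpt_gt0 k p : vpt (k, p) -> 0 < k.
Proof. by rewrite /vpt; case: k => //=; rewrite wd0. Qed.

Ltac if_cases := repeat match goal with
  | |- context [if ?b then _ else _] =>
      lazymatch b with
      | context [if _ then _ else _] => fail
      | _ => case: (boolP b) => ?
      end end.

Lemma mate_up m k p : k < N -> vpt (k, p) ->
  [/\ vpt (mate m (k, p, true)).1, mate m (mate m (k, p, true)) = (k, p, true) &
      ((mate m (k, p, true)).2 == true) = ((mate m (k, p, true)).1.1 == k)].
Proof.
move=> kN; rewrite /vpt /= => /andP[_ pk].
have kNN : (k == N) = false by apply/eqP; lia.
have ok := slice_wf kN; have wk := wdS kN.
(* Abbreviating the first mate lets its cases be resolved before the second application is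
   unfolded. *)
have: exists d, d = mate m (k, p, true) by eexists.
case=> d dE; rewrite -dE; move: dE.
rewrite /slice_ok in ok; rewrite {1}/mate /= /up_mate kNN.
case skE: (sl k) ok wk => [i|i|i o] /= ok wk; if_cases => -> /=; split;
  rewrite /mate /= /up_mate /down_mate ?kNN ?skE ?kN ?wk /=; if_cases;
  try lia; try (congr (_, _, _); lia).
Qed.

Lemma mate_down m k p : k < N -> vpt (k.+1, p) ->
  [/\ vpt (mate m (k.+1, p, false)).1,
      mate m (mate m (k.+1, p, false)) = (k.+1, p, false) &
      ((mate m (k.+1, p, false)).2 == false) = ((mate m (k.+1, p, false)).1.1 == k.+1)].
Proof.
move=> kN; rewrite /vpt /= => /andP[_ pk].
have kNN : (k == N) = false by apply/eqP; lia.
have ok := slice_wf kN; have wk := wdS kN.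
have: exists d, d = mate m (k.+1, p, false) by eexists.
case=> d dE; rewrite -dE; move: dE.
rewrite /slice_ok in ok; rewrite {1}/mate /= /down_mate.
case skE: (sl k) ok wk => [i|i|i o] /= ok wk; rewrite wk in pk; if_cases => -> /=; split;
  rewrite /mate /= /up_mate /down_mate ?kNN ?skE ?kN ?wk /=; if_cases;
  try lia; try (congr (_, _, _); lia).
Qed.

Lemma mate_top m p : vpt (N, p) ->
  [/\ vpt (mate m (N, p, true)).1, mate m (mate m (N, p, true)) = (N, p, true) &
      mate m (N, p, true) != (N, p, true)] /\
  ((mate m (N, p, true)).2 == true) = ((mate m (N, p, true)).1.1 == N).
Proof.
rewrite /vpt /= => /andP[_]; rewrite wdN => pk.
rewrite /mate /up_mate /= !eqxx /=; split=> //; split.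
- by rewrite leqnn /= wdN; if_cases; lia.
- by if_cases; congr (_, _, _); lia.
- by rewrite !xpair_eqE /= eqxx andbT /=; if_cases; lia.
Qed.

Lemma mateP m d : vpt d.1 ->
  [/\ vpt (mate m d).1, mate m (mate m d) = d &
      ((mate m d).2 == d.2) = ((mate m d).1.1 == d.1.1)].
Proof.
case: d => -[k p] [] vd.
  case: (eqVneq k N) vd => [->|kN] vd; first by case: (mate_top m vd) => [[? ? ?] ?].
  by apply: mate_up; rewrite // ltn_neqAle kN; case/andP: vd.
have:= vpt_gt0 vd; case: k vd => // k vd _.
by apply: mate_down => //; case/andP: vd.
Qed.

Definition estate (m : nat -> bool) := edges_with w (fun k => Some (m k)).

Lemma edges_withP m e :
  reflect ((exists2 k, k < N & e \in slice_edges w k (m k)) \/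
           (exists2 j, j < hm & e = ((N, j), (N, j + hm))))
          (e \in edges_with w m).
Proof.
rewrite /edges_with mem_cat; apply: (iffP orP) => -[].
- case/flatten_mapP=> k; rewrite mem_iota => /= kN ek; left; by exists k.
- by case/mapP=> j; rewrite mem_iota => /= jh ->; right; exists j.
- by case=> k kN ek; left; apply/flatten_mapP; exists k; rewrite ?mem_iota.
- by case=> j jh ->; right; apply/mapP; exists j; rewrite ?mem_iota.
Qed.

Lemma edge_mate m p p' : (p, p') \in estate m ->
  vpt p /\ exists b, (mate m (p, b)).1 = p'.
Proof.
case/edges_withP=> [[k kN]|[j jh [-> ->]]]; last first.
  split; first by rewrite /vpt leqnn wdN /=; lia.
  by exists true; rewrite /mate /up_mate /= eqxx jh.
have ok := slice_wf kN; have wk := wdS kN.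
have kNN : (k == N) = false by apply/eqP; lia.
rewrite /slice_ok in ok; rewrite /slice_edges.
case skE: (sl k) ok wk => [i|i|i o] /= ok wk.
- rewrite inE => /orP[/eqP[-> ->]|/mapP[q]].
    split; first by rewrite /vpt /= kN wk; lia.
    by exists false; rewrite /mate /= /down_mate skE eqxx.
  rewrite mem_iota => /= qk [-> ->]; split; first by rewrite /vpt /= ltnW.
  by exists true; rewrite /mate /= /up_mate kNN skE.
- rewrite inE => /orP[/eqP[-> ->]|/mapP[q]].
    split; first by rewrite /vpt /= ltnW //; lia.
    by exists true; rewrite /mate /= /up_mate kNN skE eqxx.
  rewrite mem_filter mem_iota => /andP[/andP[/negbTE q1 /negbTE q2] /= qk] [-> ->].
  split; first by rewrite /vpt /= ltnW.
  by exists true; rewrite /mate /= /up_mate kNN skE q1 q2.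
rewrite mem_cat => /orP[|/mapP[q]]; last first.
  rewrite mem_filter mem_iota => /andP[/andP[/negbTE q1 /negbTE q2] /= qk] [-> ->].
  split; first by rewrite /vpt /= ltnW.
  by exists true; rewrite /mate /= /up_mate kNN skE q1 q2.
have iS : (i.+1 == i) = false by apply/eqP; lia.
case mk: (m k); rewrite /= !inE => /orP[]/eqP[-> ->].
- by split; [rewrite /vpt /=; lia | exists true; rewrite /mate /= /up_mate kNN skE mk eqxx].
- by split; [rewrite /vpt /=; lia | exists true; rewrite /mate /= /up_mate kNN skE mk iS eqxx].
- by split; [rewrite /vpt /=; lia | exists true; rewrite /mate /= /up_mate kNN skE mk eqxx].
- by split; [rewrite /vpt /= kN wk; lia | exists false; rewrite /mate /= /down_mate skE mk eqxx].
Qed.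

Lemma mate_edge m p b : vpt p ->
  (p, (mate m (p, b)).1) \in estate m \/ ((mate m (p, b)).1, p) \in estate m.
Proof.
have sliceI k e : k < N -> e \in slice_edges w k (Some (m k)) -> e \in estate m.
  by move=> kN ek; apply/edges_withP; left; exists k.
case: p b => k p [] vp.
  case: (eqVneq k N) vp => [->|kN] vp.
    move: vp; rewrite /vpt /= wdN => /andP[_ pk].
    rewrite /mate /= /up_mate eqxx /=; case: ltnP => ph; [left|right].
      by apply/edges_withP; right; exists p.
    apply/edges_withP; right; exists (p - hm); first by lia.
    by congr (_, (_, _)); lia.
  have {}kN : k < N by rewrite ltn_neqAle kN; case/andP: vp.
  have ok := slice_wf kN; have kNN : (k == N) = false by apply/eqP; lia.
  move: vp; rewrite /vpt /= => /andP[_ pk].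
  rewrite /mate /= /up_mate kNN; rewrite /slice_ok in ok.
  case skE: (sl k) ok => [i|i|i o] /= ok.
  - left; apply: (sliceI k) => //; rewrite /slice_edges skE inE; apply/orP; right.
    by apply/mapP; exists p; rewrite ?mem_iota.
  - case: eqVneq => [->|p1]; last case: eqVneq => [->|p2]; [left|right|left];
      apply: (sliceI k) => //; rewrite /slice_edges skE inE ?eqxx //.
    by apply/orP; right; apply/mapP; exists p; rewrite // mem_filter mem_iota p1 p2.
  - case: eqVneq => [->|p1]; last case: eqVneq => [->|p2].
    + by left; case mk: (m k); apply: (sliceI k) => //; rewrite /slice_edges skE mk !inE eqxx.
    + case mk: (m k); [left|right]; apply: (sliceI k) => //;
      by rewrite /slice_edges skE mk !inE eqxx ?orbT.
    + left; apply: (sliceI k) => //; rewrite /slice_edges skE mem_cat; apply/orP; right.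
      by apply/mapP; exists p; rewrite // mem_filter mem_iota p1 p2.
have:= vpt_gt0 vp; case: k vp => // k vp _.
have kN : k < N by case/andP: vp.
have ok := slice_wf kN; have wk := wdS kN.
move: vp; rewrite /vpt /= => /andP[_ pk].
rewrite /mate /= /down_mate; rewrite /slice_ok in ok.
case skE: (sl k) ok wk => [i|i|i o] /= ok wk; rewrite wk in pk.
- case: eqVneq => [->|p1]; last case: eqVneq => [->|p2]; [left|right|right];
    apply: (sliceI k) => //; rewrite /slice_edges skE inE ?eqxx //.
  apply/orP; right; apply/mapP; exists (if p < i then p else p - 2).
    by rewrite mem_iota; if_cases; lia.
  by congr (_, (_, _)); if_cases; lia.
- right; apply: (sliceI k) => //; rewrite /slice_edges skE inE; apply/orP; right.
  apply/mapP; exists (if p < i then p else p.+2).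
    by rewrite mem_filter mem_iota; if_cases; lia.
  by congr (_, (_, _)); if_cases; lia.
- case: eqVneq => [->|p1]; last case: eqVneq => [->|p2].
  + by case mk: (m k); [right|left]; apply: (sliceI k) => //;
      rewrite /slice_edges skE mk !inE eqxx ?orbT.
  + by right; case mk: (m k); apply: (sliceI k) => //;
      rewrite /slice_edges skE mk !inE eqxx ?orbT.
  + right; apply: (sliceI k) => //; rewrite /slice_edges skE mem_cat; apply/orP; right.
    by apply/mapP; exists p; rewrite // mem_filter mem_iota p1 p2.
Qed.

(** An orientation points along exactly one of the two darts of an edge: a vertical edge keeps [o]
    and switches the side, a horizontal one keeps the side and switches [o]. *)
Lemma orient_mate m (o : pt -> bool) d : orient_ok (estate m) o -> vpt d.1 ->
  (o (mate m d).1 == (mate m d).2) = (o d.1 != d.2).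
Proof.
move=> /allP oo vd; have [_ _] := mateP m vd.
have [] := @mate_edge m d.1 d.2 vd; rewrite -surjective_pairing => /oo /= /eqP.
  rewrite [d.1.1 == _]eq_sym => + E; rewrite -E.
  by case: (o d.1); case: (o (mate m d).1); case: (mate m d).2; case: (d.2).
move=> + E; rewrite -E.
by case: (o d.1); case: (o (mate m d).1); case: (mate m d).2; case: (d.2).
Qed.
End Mates.

(** * Darts on the finite type of nodes, and corners of crossings *)

Section Nodes.
Variable w : seq slice.
Local Notation N := (size w).
Hypothesis wfw : wf w.

Local Notation node := (node w).
Local Notation vpt := (vpt w).
Local Notation nd := (@nd w).
Local Notation state := (state w).

Lemma nd_np (v : node) : nd (np v) = v.
Proof. by case: v => a b; rewrite /Defs.nd /np /= !inord_val. Qed.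

Lemma np_nd p : vpt p -> np (nd p) = p.
Proof.
case: p => k p /andP[/= kN pk]; have := wd_le wfw kN => le.
by rewrite /np /Defs.nd /= !inordK //; lia.
Qed.

Lemma vpt_np (v : node) : vpt (np v) = valid_node v.
Proof. by rewrite /vpt /= -ltnS ltn_ord. Qed.

Lemma valid_nd p : vpt p -> valid_node (nd p).
Proof. by move=> vp; rewrite -vpt_np np_nd. Qed.

Definition mode (s : state) (k : nat) : bool := cross_o w k != bit s k.

(** The identity off the diagram makes this a total involution of a finite type, as the orbit
    argument requires. *)
Definition nmate (s : state) (d : node * bool) : node * bool :=
  if valid_node d.1 then
    let d' := mate w (mode s) (np d.1, d.2) in (nd d'.1, d'.2) else d.

Lemma valid_nmate s d : valid_node (nmate s d).1 = valid_node d.1.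
Proof.
rewrite /nmate; case: ifP => // vd /=; rewrite valid_nd //.
by case: (@mateP w wfw (mode s) (np d.1, d.2)); rewrite ?vpt_np.
Qed.

Lemma nmateK s : involutive (nmate s).
Proof.
move=> d; rewrite {1}/nmate valid_nmate; case: ifP => vd; rewrite /nmate vd //=.
have [] := @mateP w wfw (mode s) (np d.1, d.2); rewrite ?vpt_np // => v1 E _.
by rewrite np_nd // -surjective_pairing E /= nd_np -surjective_pairing.
Qed.

Definition nadj s : rel node := fun u v => [exists b, (nmate s (u, b)).1 == v].

Lemma circE (s : state) : circ s =2 connect (nadj s).
Proof.
have sub1 u v : (np u, np v) \in state_edges s ->
    (exists b, (nmate s (u, b)).1 = v) /\ exists b, (nmate s (v, b)).1 = u.
  move=> /(edge_mate wfw)[vu [b mb]].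
  have nb: nmate s (u, b) = (v, (mate w (mode s) (np u, b)).2).
    by rewrite /nmate -vpt_np vu /= mb nd_np.
  split; first by exists b; rewrite nb.
  by exists (nmate s (u, b)).2; rewrite nb /= -nb nmateK.
move=> u v; apply/idP/idP; apply: connect_sub => {}u {}v.
  by case/orP=> /sub1[[b mb] [b' mb']]; apply: connect1;
    apply/existsP; [exists b; rewrite mb|exists b'; rewrite mb'].
case/existsP=> b /eqP<-; case vu: (valid_node u); last first.
  by rewrite /nmate vu; apply: connect0.
apply: connect1; rewrite /adj /nmate vu /=.
have vp : vpt (np u) by rewrite vpt_np.
have [v1 _ _] := @mateP w wfw (mode s) (np u, b) vp.
by rewrite np_nd //; apply/orP; apply: mate_edge.
Qed.

Lemma nadj_sym s : symmetric (nadj s).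
Proof.
suff sub u v : nadj s u v -> nadj s v u by move=> u v; apply/idP/idP; apply: sub.
case/existsP=> b /eqP mb; apply/existsP; exists (nmate s (u, b)).2.
by rewrite -mb -surjective_pairing nmateK.
Qed.

Lemma circ_sym (s : state) : symmetric (circ s).
Proof. by move=> u v; rewrite !circE; apply: (sym_connect_sym (nadj_sym s)). Qed.

Lemma circ_trans (s : state) : transitive (circ s).
Proof. by move=> v u x; rewrite !circE; apply: connect_trans. Qed.

Lemma circ_refl (s : state) : reflexive (circ s).
Proof. by move=> u; rewrite circE connect0. Qed.

Lemma circ_valid (s : state) u v : circ s u v -> valid_node u = valid_node v.
Proof.
rewrite circE => /connectP[p pP ->]; elim: p u pP => //= x p IH u /andP[ux /IH<-].
by case/existsP: ux => b /eqP<-; rewrite valid_nmate.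
Qed.

Lemma orient_nmate s (o : pt -> bool) d : orient_ok (state_edges s) o -> valid_node d.1 ->
  (o (np (nmate s d).1) == (nmate s d).2) = (o (np d.1) != d.2).
Proof.
move=> oo vd; have vp : vpt (np d.1, d.2).1 by rewrite vpt_np.
rewrite /nmate vd /=; have [v1 _ _] := @mateP w wfw (mode s) _ vp.
by rewrite np_nd // (orient_mate wfw oo vp).
Qed.

Lemma sl_crossing (c : crossing w) : sl w (cidx c) = Cross (cross_i w (cidx c)) (cross_o w (cidx c)).
Proof. by rewrite /cross_i /cross_o /cidx; case: c => -[k kN] /=; case: sl. Qed.

Lemma cidx_lt (c : crossing w) : cidx c < N.
Proof. exact: ltn_ord. Qed.

Lemma cidx_inj : injective (@cidx w).
Proof. by move=> c c' /val_inj/val_inj. Qed.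

Lemma bit_cidx (s : state) c : bit s (cidx c) = s c.
Proof.
apply/existsP/idP => [[c' /andP[/eqP/cidx_inj->]] //|sc].
by exists c; rewrite eqxx.
Qed.

(* The dart at a corner of a crossing points into the crossing. *)
Definition corner (c : crossing w) (ab : bool * bool) : pt * bool :=
  ((cidx c + ab.1, cross_i w (cidx c) + ab.2), ~~ ab.1).

Lemma corner_inj c c' ab ab' : corner c ab = corner c' ab' -> c = c' /\ ab = ab'.
Proof.
case: ab ab' => [a b] [a' b'] [/= Ek Ei Ea].
have {Ea} Ea : a = a' by case: a a' Ea {Ek} => [] [].
rewrite Ea in Ek *; move/addIn: Ek => /cidx_inj Ec; split=> //.
rewrite Ec in Ei; move/addnI: Ei => Eb; congr (_, _).
by case: b b' Eb => [] [].
Qed.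

Lemma vpt_corner c ab : vpt (corner c ab).1.
Proof.
have kN := cidx_lt c; have := slice_wf wfw kN; have := wdS kN.
rewrite /slice_ok /vpt sl_crossing /= => wk ik.
by case: ab => [[] []] /=; rewrite ?addn1 ?addn0 ?wk; lia.
Qed.

Lemma mate_corner m c ab : mate w m (corner c ab) =
  corner c (if m (cidx c) then (~~ ab.1, ab.2) else (ab.1, ~~ ab.2)).
Proof.
have kN : (cidx c == N) = false by apply/eqP=> E; have := cidx_lt c; rewrite E ltnn.
have iS i : (i.+1 == i) = false by apply/eqP; lia.
case: ab => [[] []]; rewrite /mate /corner /= ?addn1 ?addn0 /up_mate /down_mate /=;
  rewrite ?kN sl_crossing ?iS ?eqxx; by case: (m _); rewrite /= ?addn1 ?addn0.
Qed.

(** Only the darts that point into a crossing see how it is smoothed. *)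
Lemma mate_ext m m' d : vpt d.1 ->
    (forall c ab, d = corner c ab -> m (cidx c) = m' (cidx c)) ->
  mate w m d = mate w m' d.
Proof.
have Kc k (kN : k < N) i o : sl w k = Cross i o ->
    exists c : crossing w, cidx c = k /\ cross_i w k = i.
  move=> sk; have ck : is_cross (sl w (Ordinal kN)) by rewrite /= sk.
  by exists (exist _ (Ordinal kN) ck); rewrite /cross_i sk.
case: d => -[k p] [] vp ext; rewrite /mate /=.
  rewrite /up_mate; case: eqVneq => // kN; case sk: (sl w k) => [i|i|i o] //.
  have {}kN : k < N by rewrite ltn_neqAle kN; case/andP: vp.
  have [c [ck ci]] := Kc k kN i o sk.
  case: eqVneq => [pi|_].
    by rewrite -ck (ext c (false, false)) // /corner /= ck ci !addn0 pi.
  case: eqVneq => [pi|//].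
  by rewrite -ck (ext c (false, true)) // /corner /= ck ci addn0 addn1 pi.
have := vpt_gt0 vp; case: k vp ext => // k vp ext _.
have {}kN : k < N by case/andP: vp.
rewrite /down_mate /=; case sk: (sl w k) => [i|i|i o] //.
have [c [ck ci]] := Kc k kN i o sk.
case: eqVneq => [pi|_].
  by rewrite -ck (ext c (true, false)) // /corner /= ck ci addn0 addn1 pi.
case: eqVneq => [pi|//].
by rewrite -ck (ext c (true, true)) // /corner /= ck ci !addn1 pi.
Qed.

Section Labels.
Variable dir : pt -> bool.

(** [(a, b)] is the north-west corner; label 3 is the opposite corner, supplied by the default of
    [nth]. Labels 1 and 2 trade places with the over strand, so that 1 is always joined to 0 by the
    0-smoothing. *)
Definition lcor (c : crossing w) (l : nat) : bool * bool :=
  let k := cidx c in let i := cross_i w k in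
  let a := dir (k, i) in let b := ~~ dir (k, i.+1) in
  nth (~~ a, ~~ b) (if cross_o w k then [:: (a, b); (~~ a, b); (a, ~~ b)]
                    else [:: (a, b); (a, ~~ b); (~~ a, b)]) l.

Lemma lcor_inj c l l' : l < 4 -> l' < 4 -> lcor c l = lcor c l' -> l = l'.
Proof.
rewrite /lcor; case: (cross_o _ _); case: (dir _); case: (dir _);
by case: l => [|[|[|[|]]]] //; case: l' => [|[|[|[|]]]].
Qed.

Lemma lcor_surj c ab : exists2 l, l < 4 & lcor c l = ab.
Proof.
case: ab => a b; rewrite /lcor; case: (cross_o _ _); case: (dir _); case: (dir _); case: a; case: b;
by [exists 0|exists 1|exists 2|exists 3].
Qed.

Lemma smooth4_lt b l : l < 4 -> smooth4 b l < 4.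
Proof. by case: b; case: l => [|[|[|[|]]]]. Qed.

Lemma mate_lcor (s : state) c l : l < 4 ->
  mate w (mode s) (corner c (lcor c l)) = corner c (lcor c (smooth4 (s c) l)).
Proof.
move=> l4; rewrite mate_corner /mode bit_cidx; congr corner.
rewrite /lcor; case: (cross_o _ _); case: (s c); case: (dir _); case: (dir _);
by case: l l4 => [|[|[|[|]]]].
Qed.
End Labels.
End Nodes.

(** * Faces of the cube of states *)

Lemma smooth_lt b1 b2 l : l < 8 -> smooth b1 b2 l < 8.
Proof.
by case: b1; case: b2; do 8 case: l => [//|l].
Qed.

Section Face.
Variable w : seq slice.
Hypothesis wfw : wf w.
Local Notation N := (size w).
Local Notation node := (node w).
Local Notation vpt := (vpt w).
Local Notation nd := (@nd w).
Local Notation state := (state w).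
Variables (dir : pt -> bool) (o : state -> pt -> bool).
Hypothesis oP : forall s, orient_ok (state_edges s) (o s).
Variables (c1 c2 : crossing w) (s0 : state).
Hypothesis neq_c : c1 != c2.

(** The states of the face through [s0]. *)
Definition fam (s : state) := forall c, c != c1 -> c != c2 -> s c = s0 c.

Definition fdart (l : nat) : pt * bool :=
  if l < 4 then corner c1 (lcor dir c1 l) else corner c2 (lcor dir c2 (l - 4)).
Definition fn (l : nat) : node := nd (fdart l).1.
Definition nfd (l : nat) : node * bool := (fn l, (fdart l).2).
Definition labs : seq (node * bool) := [seq nfd l | l <- iota 0 8].

Lemma vpt_fdart l : vpt (fdart l).1.
Proof. by rewrite /fdart; case: ifP => _; apply: vpt_corner. Qed.

Lemma valid_fn l : valid_node (fn l).
Proof. by apply: valid_nd => //; apply: vpt_fdart. Qed.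

Lemma np_fn l : np (fn l) = (fdart l).1.
Proof. by rewrite np_nd // vpt_fdart. Qed.

Lemma fdart_inj l l' : l < 8 -> l' < 8 -> fdart l = fdart l' -> l = l'.
Proof.
move=> l8 l8'; rewrite /fdart; case: ltnP => l4; case: ltnP => l4' /corner_inj[].
- by move=> _; apply: lcor_inj.
- by move=> E; have := neq_c; rewrite E eqxx.
- by move=> E; have := neq_c; rewrite E eqxx.
- have m4 : l - 4 < 4 by lia.
  have m4' : l' - 4 < 4 by lia.
  by move=> _ /(lcor_inj m4 m4'); lia.
Qed.

Lemma nfd_inj l l' : l < 8 -> l' < 8 -> nfd l = nfd l' -> l = l'.
Proof.
move=> l8 l8' E; apply: fdart_inj => //.
rewrite [LHS]surjective_pairing [RHS]surjective_pairing -!np_fn.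
by case: (congr1 fst E, congr1 snd E) => /= -> ->.
Qed.

Lemma labsP d : reflect (exists2 l, l < 8 & d = nfd l) (d \in labs).
Proof.
apply: (iffP mapP) => -[l]; first by rewrite mem_iota => l8 ->; exists l.
by move=> l8 ->; exists l; rewrite ?mem_iota.
Qed.

Lemma nmate_lab (s : state) l : l < 8 -> nmate s (nfd l) = nfd (smooth (s c1) (s c2) l).
Proof.
move=> l8; rewrite /nmate valid_fn /= np_fn -surjective_pairing /nfd /fn.
suff -> : mate w (mode s) (fdart l) = fdart (smooth (s c1) (s c2) l) by [].
rewrite /fdart /smooth; case: ltnP => l4.
  by rewrite mate_lcor // smooth4_lt.
by rewrite mate_lcor ?ltnNge ?leq_addr /= ?addKn //; lia.
Qed.

Lemma nmate_fam s d : fam s -> d \notin labs -> nmate s d = nmate s0 d.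
Proof.
move=> fs dl; rewrite /nmate; case: ifP => // vd.
suff -> : mate w (mode s) (np d.1, d.2) = mate w (mode s0) (np d.1, d.2) by [].
apply: mate_ext => //; first by rewrite vpt_np.
move=> c ab E; rewrite /mode !bit_cidx.
have labE cc off : (forall l, l < 4 -> fdart (off + l) = corner cc (lcor dir cc l)) ->
    off + 4 <= 8 -> c != cc.
  move=> lE off8; apply: contra dl => /eqP ccE; apply/labsP.
  have [l l4 lc] := lcor_surj dir cc ab; exists (off + l); first by lia.
  by rewrite /nfd /fn lE // lc -ccE -E /= nd_np -surjective_pairing.
rewrite fs //; first by apply: (labE c1 0) => // l l4; rewrite /fdart add0n l4.
by apply: (labE c2 4) => // l l4; rewrite /fdart ltnNge leq_addr addKn.
Qed.

(* Cutting the two crossings open leaves arcs ending at the eight labelled darts. *)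
Definition gmate (d : node * bool) : node * bool :=
  if d \in labs then d else nmate s0 d.

Lemma nmate0_labs d : d \in labs -> nmate s0 d \in labs.
Proof.
case/labsP=> l l8 ->; rewrite nmate_lab //; apply/labsP.
by exists (smooth (s0 c1) (s0 c2) l); rewrite ?smooth_lt.
Qed.

Lemma gmateK : involutive gmate.
Proof.
move=> d; rewrite {2}/gmate; case: ifP => [dl|dl]; first by rewrite /gmate dl.
rewrite /gmate nmateK //; case: ifP => // /nmate0_labs.
by rewrite nmateK // dl.
Qed.

Lemma valid_gmate d : valid_node (gmate d).1 = valid_node d.1.
Proof. by rewrite /gmate; case: ifP => // _; rewrite valid_nmate. Qed.

Definition flip (d : node * bool) : node * bool := (d.1, ~~ d.2).

Definition gadj : rel node := fun u v => [exists b, (gmate (u, b)).1 == v].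
Definition cG : rel node := connect gadj.

Lemma cG_dart u b v b' : connect (dstep flip gmate) (u, b) (v, b') = cG u v.
Proof.
have flipC u' b1 b2 : connect (dstep flip gmate) (u', b1) (u', b2).
  case: (eqVneq b1 b2) => [->|nb]; first exact: connect0.
  by apply: connect1; rewrite /dstep /flip /= !xpair_eqE eqxx /=; case: b1 b2 nb => [] [].
apply/idP/idP => [/connectP[p]|/connectP[p]].
  elim: p u b => [|[u' b''] p IH] u b /=; first by move=> _ [-> _]; apply: connect0.
  case/andP=> /orP[] /eqP E pP lE; first by case: E pP lE => -> _; apply: IH.
  apply: connect_trans (IH _ _ pP lE); apply: connect1; apply/existsP; exists b.
  by rewrite -E.
elim: p u b => [|u' p IH] u b /=; first by move=> _ ->.
case/andP=> /existsP[b0 /eqP E] pP lE.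
apply: connect_trans (flipC u b b0) _.
apply: connect_trans (IH u' (gmate (u, b0)).2 pP lE); apply: connect1.
by rewrite /dstep -E -surjective_pairing eqxx orbT.
Qed.

Lemma gadj_sym : symmetric gadj.
Proof.
suff sub u v : gadj u v -> gadj v u by move=> u v; apply/idP/idP; apply: sub.
case/existsP=> b /eqP mb; apply/existsP; exists (gmate (u, b)).2.
by rewrite -mb -surjective_pairing gmateK.
Qed.

Lemma cG_sym : symmetric cG. Proof. exact: sym_connect_sym gadj_sym. Qed.
Lemma cG_refl : reflexive cG. Proof. exact: connect0. Qed.
Lemma cG_trans : transitive cG. Proof. exact: connect_trans. Qed.

Lemma cG_valid u v : cG u v -> valid_node u = valid_node v.
Proof.
case/connectP=> p pP ->; elim: p u pP => //= x p IH u /andP[ux /IH<-].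
by case/existsP: ux => b /eqP<-; rewrite valid_gmate.
Qed.

Lemma cG_circ s u v : fam s -> cG u v -> circ s u v.
Proof.
move=> fs; rewrite circE //; apply: connect_sub => {}u {}v /existsP[b /eqP<-].
rewrite /gmate; case: ifP => dl; first exact: connect0.
by apply: connect1; apply/existsP; exists b; rewrite nmate_fam // dl.
Qed.

(* The orientation of a state points into the crossing at label [l]. *)
Definition hin (s : state) (l : nat) : bool := o s (fdart l).1 == (fdart l).2.

(** The orbit of a labelled dart under [flip] and [gmate] is the arc that starts there, and its
    second fixed dart is the other end. An orientation that enters a crossing at one end leaves one
    at the other. *)
Lemma arc_ex l : l < 8 -> exists l', [/\ l' < 8, l' != l, cG (fn l) (fn l'),
   forall k, k < 8 -> cG (fn l) (fn k) -> k = l \/ k = l' &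
   forall s, fam s -> hin s l' = ~~ hin s l].
Proof.
move=> l8.
have flipK : involutive flip by case=> u b; rewrite /flip /= negbK.
have flipN d : flip d != d by case: d => u []; rewrite /flip xpair_eqE eqxx.
have gl k : k < 8 -> gmate (nfd k) = nfd k.
  by move=> k8; rewrite /gmate; case: labsP => // -[]; exists k.
have [y [yl gy cy only hy]] := dihedral_pair flipK gmateK flipN (gl l l8).
(* A fixed dart outside [labs] would be its own mate, which the orientation of [s0] forbids. *)
have ylab : y \in labs.
  apply/negPn/negP => yN; move: gy; rewrite /gmate (negbTE yN) => gy.
  have vy : valid_node y.1.
    move: cy; rewrite [y]surjective_pairing cG_dart => /cG_valid<-; exact: valid_fn.
  have := orient_nmate wfw (oP s0) vy; rewrite gy.
  by case: eqP.
have [l' l8' yE] := labsP _ ylab; subst y.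
exists l'; split=> //.
- by apply: contraNneq yl => ->.
- by move: cy; rewrite cG_dart.
- move=> k k8 ck; case: (only (nfd k)); rewrite ?cG_dart ?gl // => /nfd_inj E;
  by [left; apply: E|right; apply: E].
(* Off the diagram [h] is the side itself, so that [flip] negates it at every dart. *)
move=> s fs; rewrite /hin -!np_fn; pose h (d : node * bool) :=
  if valid_node d.1 then o s (np d.1) == d.2 else d.2.
have := hy h; rewrite /h /= !valid_fn; apply.
  by move=> d; case: ifP => _ //; case: (o s _) (d.2) => -[].
move=> d; rewrite valid_gmate /gmate; case: ifP; rewrite ?eqxx // => dl.
rewrite -(nmate_fam fs) ?dl // => nd; case: ifP => vd.
  by rewrite (orient_nmate wfw (oP s)).
by move: nd; rewrite /nmate vd eqxx.
Qed.

Definition marc_ (l : nat) : nat :=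
  head 0 [seq k <- iota 0 8 | (k != l) && cG (fn l) (fn k)].
Definition marcs : seq nat := [seq marc_ l | l <- iota 0 8].
Definition marc l := nth 0 marcs l.

Lemma marcP l : l < 8 -> [/\ marc l < 8, marc l != l, cG (fn l) (fn (marc l)),
   forall k, k < 8 -> cG (fn l) (fn k) = (k == l) || (k == marc l) &
   forall s, fam s -> hin s (marc l) = ~~ hin s l].
Proof.
move=> l8; have [l' [l8' nl cl only hl]] := arc_ex l8.
suff -> : marc l = l'.
  split=> // k k8; apply/idP/idP => [/(only k k8)[]->|]; rewrite ?eqxx ?orbT //.
  by case/orP=> /eqP-> //; apply: cG_refl.
rewrite /marc (nth_map 0) ?size_iota // nth_iota // add0n /marc_.
set S := filter _ _.
have l'S : l' \in S by rewrite mem_filter nl cl mem_iota.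
have SE k : k \in S -> k = l'.
  rewrite mem_filter mem_iota => /andP[/andP[kl ck] /= k8].
  by case: (only k k8 ck) => // E; rewrite E eqxx in kl.
by case: S l'S SE => // x S _ SE; apply: SE; apply: mem_head.
Qed.

Lemma marcK l : l < 8 -> marc (marc l) = l.
Proof.
move=> l8; have [m8 ml cl _ _] := marcP l8; have [_ _ _ only _] := marcP m8.
have := only l l8; rewrite cG_sym cl => /esym/orP[]/eqP // E.
by rewrite -E eqxx in ml.
Qed.

Lemma marcs_pref : marcs \in prefixes 8.
Proof.
apply: prefixes_complete; first by rewrite size_map size_iota.
  rewrite map_inj_in_uniq ?iota_uniq // => i j; rewrite !mem_iota /= => i8 j8.
  have E k : k < 8 -> marc_ k = marc k.
    by move=> k8; rewrite /marc (nth_map 0) ?size_iota // nth_iota.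
  by rewrite !E // => /(congr1 marc); rewrite !marcK.
by move=> l l8; have [? ? _ _ _] := marcP l8; rewrite -/(marc _) -/(marc _) marcK.
Qed.

(** An antipodal pair of boundary points is counted once, through its member in the first half of
    the top level. *)
Definition glue_count (P : pred node) : nat :=
  count (fun j => P (nd (N, j))) (iota 0 (hm w)).
Definition qs : bitseq := [seq odd (glue_count (cG (fn l))) | l <- iota 0 8].

Lemma qsE l : l < 8 -> nth false qs l = odd (glue_count (cG (fn l))).
Proof. by move=> l8; rewrite (nth_map 0) ?size_iota // nth_iota. Qed.

Lemma qs_marc l : l < 8 -> nth false qs (marc l) = nth false qs l.
Proof.
move=> l8; have [m8 _ cl _ _] := marcP l8; rewrite !qsE //; congr odd.
apply: eq_count => j; apply/idP/idP; apply: cG_trans => //.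
by rewrite cG_sym.
Qed.

Lemma face_ok : ok_face marcs qs.
Proof.
apply: ok_faceT; first exact: marcs_pref.
  by rewrite size_map size_iota.
exact: qs_marc.
Qed.

(** * The circles of a state, read off the matching *)

Variable e : state -> seq node.
Hypothesis eP : forall s, enum_ok s (e s).

Lemma pos_lt s (u : node) : valid_node u -> pos e s (np u) < size (e s).
Proof.
by case: (eP s) => _ _ /(_ u) ex _ /ex; rewrite /pos nd_np -has_find.
Qed.

Lemma circ_rep_pos s (u : node) : valid_node u -> circ s (rep e s (pos e s (np u))) u.
Proof.
move=> vu; have := pos_lt s vu; rewrite /pos nd_np -has_find => /(nth_find (dn w)).
exact.
Qed.

Lemma pos_circ s (u v : node) : circ s u v -> pos e s (np u) = pos e s (np v).
Proof.
move=> uv; rewrite /pos !nd_np; apply: eq_find => r; apply/idP/idP => ru.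
  exact: circ_trans ru uv.
apply: circ_trans ru _ => //; by rewrite (circ_sym wfw).
Qed.

Lemma pos_eq s (u v : node) : valid_node u -> valid_node v ->
  (pos e s (np u) == pos e s (np v)) = circ s u v.
Proof.
move=> vu vv; apply/eqP/idP => [E|]; last exact: pos_circ.
apply: (@circ_trans w wfw s (rep e s (pos e s (np u)))).
  by rewrite (circ_sym wfw) circ_rep_pos.
by rewrite E circ_rep_pos.
Qed.

Lemma valid_rep s j : j < size (e s) -> valid_node (rep e s j).
Proof. by case: (eP s) => /allP ev _ _ _ js; apply: ev; apply: mem_nth. Qed.

Lemma pos_rep s j : j < size (e s) -> pos e s (np (rep e s j)) = j.
Proof.
move=> js; have vj := valid_rep js; move: (pos_lt s vj) (circ_rep_pos s vj).
move: (pos e s (np (rep e s j))) => i ps cij.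
have [_ /pairwiseP pw _ _] := eP s; have {}pw := pw (dn w).
apply/eqP; rewrite eqn_leq leqNgt (leqNgt j).
apply/andP; split; apply/negP => lt.
  by move/negP: (pw j i js ps lt); apply; rewrite (circ_sym wfw).
by move/negP: (pw i j ps js lt); apply.
Qed.

Definition Q (s : state) (l : nat) : nat := pos e s (fdart l).1.

Lemma QE s l : Q s l = pos e s (np (fn l)).
Proof. by rewrite np_fn. Qed.

Definition LS (s : state) : lstate := mk_lstate marcs qs (s c1) (s c2).
Local Notation smo s := (smooth (s c1) (s c2)).

Lemma ok_LS s l : l < 8 ->
  [/\ rt (LS s) l < 8, rt (LS s) (rt (LS s) l) = rt (LS s) l,
      rt (LS s) (marc l) = rt (LS s) l, rt (LS s) (smo s l) = rt (LS s) l
    & l \in cyc marcs (s c1) (s c2) (rt (LS s) l)].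
Proof.
move=> l8; suff: ok_lstate marcs (s c1) (s c2) (LS s).
  move=> /allP/(_ l); rewrite mem_iota => /(_ l8) /and5P[? /eqP-> /eqP-> /eqP-> ->].
  by split.
by have [ok _ _ _] := ok_squareP face_ok; apply: ok.
Qed.

Lemma circ_smooth s l : l < 8 -> circ s (fn l) (fn (smo s l)).
Proof.
move=> l8; rewrite circE //; apply: connect1; apply/existsP; exists (fdart l).2.
by rewrite -/(nfd l) nmate_lab.
Qed.

Lemma hin_smooth s l : l < 8 -> hin s (smo s l) = ~~ hin s l.
Proof.
move=> l8; have := orient_nmate wfw (oP s) (valid_fn l : valid_node (nfd l).1).
by rewrite nmate_lab //= /hin !np_fn => ->.
Qed.

Lemma cycE s l : cyc marcs (s c1) (s c2) l =
  let F x := smo s (marc x) in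
  [:: l; marc l; F l; marc (F l); F (F l); marc (F (F l));
      F (F (F l)); marc (F (F (F l)))].
Proof. by []. Qed.

(** Every move of the walk stays on the circle and exchanges entering with leaving, so [hin]
    alternates along [cyc]. *)
Lemma cycP s l x : fam s -> l < 8 -> x \in cyc marcs (s c1) (s c2) l ->
  [/\ x < 8, circ s (fn l) (fn x) &
      hin s x = hin s l (+) odd (index x (cyc marcs (s c1) (s c2) l))].
Proof.
move=> fs l8 xc.
pose P y b := [/\ y < 8, circ s (fn l) (fn y) & hin s y = hin s l (+) b].
have Pm y b : P y b -> P (marc y) (~~ b).
  case=> y8 cy hy; have [? _ cG_y _ /(_ s fs) hm_y] := marcP y8; split=> //.
    exact: circ_trans cy (cG_circ fs cG_y).
  by rewrite hm_y hy addbN.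
have Ps y b : P y b -> P (smo s y) (~~ b).
  case=> y8 cy hy; split; first exact: smooth_lt.
    exact: circ_trans cy (circ_smooth s y8).
  by rewrite hin_smooth // hy addbN.
have P0 : P l false by split; rewrite ?circ_refl ?addbF.
suff PP i : i < 8 -> P (nth 0 (cyc marcs (s c1) (s c2) l) i) (odd i).
  by have := PP (index x (cyc marcs (s c1) (s c2) l)); rewrite nth_index // index_mem; apply.
have P1 := Pm _ _ P0; have P2 := Ps _ _ P1; have P3 := Pm _ _ P2.
have P4 := Ps _ _ P3; have P5 := Pm _ _ P4; have P6 := Ps _ _ P5; have P7 := Pm _ _ P6.
by rewrite cycE; move: i => [|[|[|[|[|[|[|[|i]]]]]]]].
Qed.

Lemma rt_circ s l : fam s -> l < 8 -> circ s (fn (rt (LS s) l)) (fn l).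
Proof.
move=> fs l8; have [r8 _ _ _ lc] := ok_LS s l8.
by case: (cycP fs r8 lc).
Qed.

Lemma hin_rt s l : fam s -> l < 8 ->
  hin s l = hin s (rt (LS s) l) (+) nth false (lpar (LS s)) l.
Proof.
move=> fs l8; have [r8 _ _ _ lc] := ok_LS s l8.
have [_ _ ->] := cycP fs r8 lc.
by rewrite [in RHS](nth_map 0) ?size_iota // nth_iota.
Qed.

(** A path on the circle stays inside one arc until it traverses a smoothing, which leads to a label
    with the same root. *)
Lemma circ_fnP s l v : fam s -> l < 8 ->
  reflect (exists k, [/\ k < 8, rt (LS s) k = rt (LS s) l & cG (fn k) v]) (circ s (fn l) v).
Proof.
move=> fs l8; apply: (iffP idP) => [|[k [k8 rk ckv]]]; last first.
  apply: (@circ_trans w wfw s (fn k)); last exact: cG_circ.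
  apply: (@circ_trans w wfw s (fn (rt (LS s) l))); first by rewrite (circ_sym wfw) rt_circ.
  by rewrite -rk rt_circ.
rewrite circE // => /connectP[p pP ->] {v}; elim/last_ind: p pP => [_|p v IH].
  by exists l; split=> //; apply: cG_refl.
rewrite rcons_path last_rcons => /andP[/IH{IH}[k [k8 rk ck]] /existsP[b /eqP<-]].
case: (boolP ((last (fn l) p, b) \in labs)) => [/labsP[k' k8' E]|Nl]; last first.
  exists k; split=> //; apply: cG_trans ck _; apply: connect1; apply/existsP; exists b.
  by rewrite /gmate (negbTE Nl) nmate_fam.
exists (smo s k'); split; rewrite ?smooth_lt //.
  have [_ _ _ -> _] := ok_LS s k8'; rewrite -rk.
  have [_ _ _ only _] := marcP k8; move: ck.
  have -> : last (fn l) p = fn k' by case: (congr1 fst E).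
  rewrite only // => /orP[]/eqP-> //.
  by have [_ _ -> _ _] := ok_LS s k8.
by rewrite E nmate_lab //; apply: cG_refl.
Qed.

Lemma circ_rt s l l' : fam s -> l < 8 -> l' < 8 ->
  circ s (fn l) (fn l') = (rt (LS s) l == rt (LS s) l').
Proof.
move=> fs l8 l8'; apply/(circ_fnP _ fs l8)/eqP => [[k [k8 <-]]|E].
  have [_ _ _ only _] := marcP k8; rewrite only // => /orP[]/eqP-> //.
  by have [_ _ -> _ _] := ok_LS s k8.
by exists l'; split=> //; apply: cG_refl.
Qed.

Lemma Q_eq s l l' : fam s -> l < 8 -> l' < 8 ->
  (Q s l == Q s l') = (rt (LS s) l == rt (LS s) l').
Proof. by move=> fs l8 l8'; rewrite !QE pos_eq ?valid_fn // circ_rt. Qed.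

Lemma Q_rt s l : fam s -> l < 8 -> Q s (rt (LS s) l) = Q s l.
Proof.
move=> fs l8; have [r8 rr _ _ _] := ok_LS s l8.
by apply/eqP; rewrite Q_eq // rr.
Qed.

Lemma Q_lt s l : Q s l < size (e s).
Proof. by rewrite QE pos_lt ?valid_fn. Qed.

(** The arcs of a circle partition its nodes, and [k < marc k] selects one end of each arc. *)
Lemma circ_count s l v : fam s -> l < 8 ->
  circ s (fn l) v = count (fun k =>
    [&& rt (LS s) k == rt (LS s) l, k < marc k & cG (fn k) v]) (iota 0 8) :> nat.
Proof.
move=> fs l8; case: (circ_fnP v fs l8) => [ex|nex]; last first.
  apply/esym/eqP; rewrite eqn0Ngt -has_count; apply/hasPn => k.
  rewrite mem_iota => /= k8; apply/negP => /and3P[/eqP rk _ ck].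
  by apply: nex; exists k.
have {ex} [k [k8 rk ltk ck]] : exists k,
    [/\ k < 8, rt (LS s) k = rt (LS s) l, k < marc k & cG (fn k) v].
  case: ex => k [k8 rk ck]; have [m8 nm cm _ _] := marcP k8.
  case: (ltngtP k (marc k)) => lt; first by exists k.
    exists (marc k); split=> //.
    - by have [_ _ -> _ _] := ok_LS s k8.
    - by rewrite marcK.
    - by apply: cG_trans ck; rewrite cG_sym.
  by rewrite {2}lt eqxx in nm.
rewrite (@eq_in_count _ _ (pred1 k)); last first.
  move=> k'; rewrite mem_iota => /= k8'; apply/and3P/eqP => [[_ lt' ck']|->].
    have [_ _ _ only _] := marcP k8.
    have := only k' k8'; rewrite (cG_trans ck) 1?cG_sym // => /esym/orP[]/eqP // E.
    by move: lt'; rewrite E marcK // => lt'; move: (ltn_trans ltk lt'); rewrite ltnn.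
  by rewrite rk eqxx.
by rewrite count_uniq_mem ?iota_uniq // mem_iota k8.
Qed.

(** The boundary points of a circle are those of its arcs; exchanging the two sums reduces the count
    modulo 2 to the parities [qs]. *)
Lemma proj_Q s l : fam s -> l < 8 ->
  proj s (rep e s (Q s l)) = nth false (lproj (LS s)) (rt (LS s) l).
Proof.
move=> fs l8; have [r8 _ _ _ _] := ok_LS s l8.
rewrite [RHS](nth_map 0) ?size_iota // nth_iota // add0n /proj.
have cE v : circ s (rep e s (Q s l)) v = circ s (fn l) v.
  have c : circ s (rep e s (Q s l)) (fn l) by rewrite QE circ_rep_pos ?valid_fn.
  apply/idP/idP; apply: circ_trans => //.
  by rewrite (circ_sym wfw).
under eq_count => j do rewrite cE.
have countE T (a : pred T) r : count a r = \sum_(i <- r) a i.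
  by rewrite -sum1_count big_mkcond /=; apply: eq_bigr => i _; case: (a i).
rewrite countE; under eq_bigr => j _ do rewrite circ_count // countE.
have oddE T (F : T -> nat) r : odd (\sum_(i <- r) F i) = \big[addb/false]_(i <- r) odd (F i).
  exact: (big_morph odd oddD (erefl (odd 0))).
rewrite exchange_big [in RHS]countE !oddE big_seq [in RHS]big_seq; apply: eq_bigr => k; rewrite mem_iota => /= k8.
have -> : nth 0 [seq root8 marcs (s c1) (s c2) l0 | l0 <- iota 0 8] k = rt (LS s) k by [].
rewrite -/(marc k) qsE //; case: eqP => _ /=; last by rewrite big1.
case: (k < marc k); last by rewrite big1.
by rewrite oddb /glue_count countE.
Qed.

Lemma lT_lt s r : r \in lT (LS s) -> r < 8 /\ rt (LS s) r = r.
Proof. by rewrite mem_filter mem_iota => /andP[/eqP ? /= ?]. Qed.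

Lemma rt_lT s l : l < 8 -> rt (LS s) l \in lT (LS s).
Proof.
move=> l8; have [r8 rr _ _ _] := ok_LS s l8; rewrite mem_filter.
apply/andP; split; first by apply/eqP; exact: rr.
by rewrite mem_iota; apply/andP; split=> //; exact: r8.
Qed.

Lemma lT_uniq s : uniq (lT (LS s)).
Proof. by rewrite filter_uniq // iota_uniq. Qed.

Definition loc s (x : basis e s) : bitseq := [seq lab x (Q s r) | r <- lT (LS s)].

Lemma llabE s (x : basis e s) l : fam s -> l < 8 -> llab (LS s) (loc x) l = lab x (Q s l).
Proof.
move=> fs l8; have rT := rt_lT s l8.
by rewrite /llab (nth_map 0) ?index_mem // nth_index // Q_rt.
Qed.

(** An admissible enumeration allows a projective circle only in the last position, so two of them
    would coincide. *)
Lemma one_proj_LS s : fam s -> one_proj (LS s).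
Proof.
move=> fs; rewrite /one_proj.
have lastP r : r \in lT (LS s) -> nth false (lproj (LS s)) r -> Q s r = (size (e s)).-1.
  move=> /lT_lt[r8 rr] pr; have := Q_lt s r.
  case: (eP s) => _ _ _ /(_ (Q s r)) np; move: np.
  rewrite -/(rep e s (Q s r)) proj_Q // rr pr => np lt.
  by case: (ltnP (Q s r).+1 (size (e s))) => [/np //|]; lia.
rewrite -size_filter; case E: (filter _ _) => [|r1 [|r2 t]] //.
have r1P : r1 \in [seq r <- lT (LS s) | nth false (lproj (LS s)) r] by rewrite E mem_head.
have r2P : r2 \in [seq r <- lT (LS s) | nth false (lproj (LS s)) r] by rewrite E !inE eqxx orbT.
have := filter_uniq (nth false (lproj (LS s))) (lT_uniq s); rewrite E /= inE => /andP[+ _].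
move: r1P; rewrite mem_filter => /andP[p1 t1].
move: r2P; rewrite mem_filter => /andP[p2 t2].
have := lastP _ t1 p1; rewrite -(lastP _ t2 p2) => /eqP.
have [l1 e1] := lT_lt t1; have [l2 e2] := lT_lt t2.
by rewrite Q_eq // e1 e2 => ->.
Qed.

(** * Corners in the oriented chart, and circles common to several states *)

Hypothesis dirP : orient_ok (link_edges w) dir.

Lemma dir_strands (c : crossing w) : let k := cidx c in let i := cross_i w k in
  dir (k.+1, i.+1) = dir (k, i) /\ dir (k.+1, i) = dir (k, i.+1).
Proof.
move=> k i; have kN : k < N := cidx_lt c; have sk : sl w k = Cross i _ := sl_crossing c.
have kS : (k != k.+1) by rewrite neq_ltn ltnSn.
have in_link ed : ed \in cross_conn k i None -> ed \in link_edges w.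
  by move=> ed_in; apply/edges_withP; left; exists k => //; rewrite /slice_edges sk mem_cat ed_in.
have dirE ed : ed \in cross_conn k i None -> (dir ed.1 == dir ed.2) == (ed.1.1 != ed.2.1).
  by move/in_link; move: ed; apply/allP.
split; apply/esym/eqP.
  by have := dirE ((k, i), (k.+1, i.+1)); rewrite mem_head => /(_ isT); rewrite /= kS => /eqP.
by have := dirE ((k, i.+1), (k.+1, i)); rewrite mem_behead ?mem_head // => /(_ isT);
  rewrite /= kS => /eqP.
Qed.

(** North-east and south-west carry the labels 1 and 2, in an order that depends on the crossing.
    The diagram leaves at north-east and enters at south-west, so being locally consistent means
    leaving at 1 or 2 in either case. *)
Lemma corners_spec (c : crossing w) : let L l := corner c (lcor dir c l) in
  [/\ NW dir c = (L 0).1, SE dir c = (L 3).1 &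
      exists k1 k2, [/\ (k1 = 1 /\ k2 = 2) \/ (k1 = 2 /\ k2 = 1),
        NE dir c = (L k1).1, SW dir c = (L k2).1,
        dir (NE dir c) = ~~ (L k1).2 & dir (SW dir c) = (L k2).2]].
Proof.
move=> L; rewrite {}/L; have [] := dir_strands c.
rewrite /NW /SE /NE /SW /lcor /corner.
move: (cidx c) => k; move: (cross_i w k) => i; set dA := dir (k, i); set dB := dir (k, i.+1).
move=> d1 d2; case: (cross_o w k); case EA: dA d1; case EB: dB d2 => /= d1 d2;
  rewrite ?addn0 ?addn1; split=> //;
  first [by exists 1, 2; rewrite /= ?addn0 ?addn1; split=> //; left
        |by exists 2, 1; rewrite /= ?addn0 ?addn1; split=> //; right].
Qed.

(** From [u] on, both states make the same moves, and each move affects both orientations alike, so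
    their comparison is constant along the circle. *)
Lemma same_circle (t t' : state) (u : node) : valid_node u ->
    (forall x b, circ t u x -> nmate t (x, b) = nmate t' (x, b)) ->
  forall v, circ t u v = circ t' u v /\
    (circ t u v -> (o t (np v) == o t' (np v)) = (o t (np u) == o t' (np u))).
Proof.
move=> vu same.
have step x y : circ t u x -> nadj t x y || nadj t' x y ->
    [/\ circ t u y, nadj t x y, nadj t' x y &
        (o t (np y) == o t' (np y)) = (o t (np x) == o t' (np x))].
  move=> ux xy; have [b by_] : exists b, (nmate t (x, b)).1 = y.
    by case/orP: xy => /existsP[b /eqP <-]; exists b; rewrite // same.
  have xy1 : nadj t x y by apply/existsP; exists b; rewrite by_.
  have xy2 : nadj t' x y by apply/existsP; exists b; rewrite -same // by_.
  split=> //; first by apply: circ_trans ux _ => //; rewrite circE //; apply: connect1.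
  have vx : valid_node (x, b).1 by rewrite -(circ_valid wfw ux).
  have := orient_nmate wfw (oP t) vx; have := orient_nmate wfw (oP t') vx.
  rewrite -same // by_ /=; move: (nmate t (x, b)).2 => b2.
  by case: b2; case: (b); case: (o t _); case: (o t' _); case: (o t _); case: (o t' _).
have path_t p x : circ t u x -> path (nadj t) x p ->
    circ t' x (last x p) /\
    (o t (np (last x p)) == o t' (np (last x p))) = (o t (np x) == o t' (np x)).
  elim: p x => [|y p IH] x ux /=; first by rewrite circ_refl.
  case/andP=> xy py; have [|uy _ xy' oy] := step x y ux; first by rewrite xy.
  have [cy ->] := IH y uy py; split=> //; apply: circ_trans cy => //.
  by rewrite circE //; apply: connect1.
move=> v; split; last first.
  rewrite {1}circE // => /connectP[p pP ->].
  by have [] := path_t p u (circ_refl wfw t u) pP.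
have circ_path t1 : circ t1 u v -> exists2 p, path (nadj t1) u p & v = last u p.
  by rewrite circE // => /connectP.
apply/idP/idP => /circ_path[p pP ->].
  by have [] := path_t p u (circ_refl wfw t u) pP.
suff path_t' x : circ t u x -> path (nadj t') x p -> circ t u (last x p).
  exact: path_t' (circ_refl wfw t u) pP.
elim: p x {pP} => [|y p IH] x ux //= /andP[xy py].
by have [|uy _ _ _] := step x y ux; rewrite ?xy ?orbT //; apply: IH.
Qed.

Lemma circ_repQ s u v : valid_node u -> circ s (rep e s (pos e s (np u))) v = circ s u v.
Proof.
move=> vu; have c := circ_rep_pos s vu; apply/idP/idP; apply: circ_trans => //.
by rewrite (circ_sym wfw).
Qed.

(* The circles that meet neither crossing; they are common to the four states. *)
Definition spec : seq nat :=
  [seq j <- iota 0 (size (e s0)) | j \notin [seq Q s0 l | l <- iota 0 8]].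
Definition sp (j : nat) : node := rep e s0 j.
Definition sigma (s : state) (j : nat) : nat := pos e s (np (sp j)).

Lemma fam0 : fam s0. Proof. by []. Qed.

Lemma spec_lt j : j \in spec -> j < size (e s0).
Proof. by rewrite mem_filter mem_iota => /andP[_ /andP[_]]. Qed.

Lemma valid_sp j : j \in spec -> valid_node (sp j).
Proof. by move/spec_lt; apply: valid_rep. Qed.

Lemma spec_free s j l : fam s -> j \in spec -> l < 8 -> circ s (fn l) (sp j) = false.
Proof.
move=> fs js l8; apply/negP => /(circ_fnP _ fs l8)[k [k8 _ /(cG_circ fam0) ck]].
move: (js); rewrite mem_filter => /andP[/negP nin _]; apply: nin; apply/mapP; exists k; rewrite ?mem_iota //.
by rewrite QE (pos_circ ck) pos_rep // spec_lt.
Qed.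

Lemma spec_nmate s j x b : fam s -> j \in spec -> circ s (sp j) x ->
  nmate s (x, b) = nmate s0 (x, b).
Proof.
move=> fs js cx; apply: nmate_fam => //; apply/negP => /labsP[l l8 /(congr1 fst) /= xE].
by have := spec_free fs js l8; rewrite (circ_sym wfw) -xE cx.
Qed.

Lemma spec_circle s j v : fam s -> j \in spec ->
  circ s (sp j) v = circ s0 (sp j) v /\
  (circ s (sp j) v -> (o s (np v) == o s0 (np v)) = (o s (np (sp j)) == o s0 (np (sp j)))).
Proof.
move=> fs js; apply: same_circle; first exact: valid_sp.
by move=> x b; apply: spec_nmate.
Qed.

Lemma sigma_lt s j : j \in spec -> sigma s j < size (e s).
Proof. by move=> js; rewrite pos_lt // valid_sp. Qed.

Lemma sigma_inj s : fam s -> {in spec &, injective (sigma s)}.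
Proof.
move=> fs i j iS jS /eqP; rewrite pos_eq ?valid_sp //.
have [-> _] := spec_circle (sp j) fs iS.
by rewrite -pos_eq ?valid_sp // !pos_rep ?spec_lt // => /eqP.
Qed.

Lemma sigma_neq s j l : fam s -> j \in spec -> l < 8 -> (sigma s j == Q s l) = false.
Proof.
move=> fs js l8; rewrite QE pos_eq ?valid_sp ?valid_fn // (circ_sym wfw).
exact: spec_free.
Qed.

Lemma Q_inj s : fam s -> {in lT (LS s) &, injective (Q s)}.
Proof.
move=> fs a b /lT_lt[a8 ra] /lT_lt[b8 rb] /eqP; rewrite Q_eq // ra rb.
by move/eqP.
Qed.

(** A common order for the circles of all states of the face, against which the signs of the chosen
    enumerations are measured: touched circles by least label, then the others as in [s0]. *)
Definition positions s := map (Q s) (lT (LS s)) ++ map (sigma s) spec.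

Lemma positions_uniq s : fam s -> uniq (positions s).
Proof.
move=> fs; rewrite cat_uniq (map_inj_in_uniq (Q_inj fs)) lT_uniq.
rewrite (map_inj_in_uniq (sigma_inj fs)) filter_uniq ?iota_uniq // andbT.
apply/hasPn => _ /mapP[j js ->]; apply/mapP => -[r /lT_lt[r8 _] /eqP].
by rewrite sigma_neq.
Qed.

(** A node whose circle in [s0] is touched lies on one of the arcs, hence on a touched circle of
    [s]; any other node keeps its circle. *)
Lemma positions_perm s : fam s -> perm_eq (iota 0 (size (e s))) (positions s).
Proof.
move=> fs; apply: uniq_perm; [exact: iota_uniq|exact: positions_uniq|move=> j].
rewrite mem_iota add0n mem_cat; apply/idP/idP => [/andP[_ js]|]; last first.
  by case/orP => /mapP[i iS ->]; rewrite ?Q_lt ?sigma_lt.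
have vj := valid_rep js; have jE := pos_rep js; move: (rep e s j) vj jE => v vj jE.
case: (boolP (pos e s0 (np v) \in [seq Q s0 l | l <- iota 0 8])).
  case/mapP=> l; rewrite mem_iota => /andP[_ l8] /eqP; rewrite QE pos_eq ?valid_fn //.
  rewrite (circ_sym wfw) => /(circ_fnP _ fam0 l8)[k [k8 _ /(cG_circ fs)/pos_circ]].
  by rewrite jE -QE -Q_rt // => <-; apply/orP; left; apply: map_f; exact: rt_lT.
move=> NQ; have iS : pos e s0 (np v) \in spec.
  by rewrite mem_filter NQ mem_iota; apply: pos_lt.
apply/orP; right; apply/mapP; exists (pos e s0 (np v)) => //.
rewrite -jE; apply: pos_circ; rewrite (circ_sym wfw).
have [-> _] := spec_circle v fs iS.
exact: circ_rep_pos.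
Qed.

(** * One edge of the face *)

Section Edge.
Variables (c : crossing w) (off : nat) (s s' : state).
Hypotheses (fs : fam s) (fs' : fam s') (sc : s c = false) (sc' : s' c = true).
Hypothesis ss' : forall c', c' != c -> s c' = s' c'.
Hypothesis offP : (c = c1 /\ off = 0) \/ (c = c2 /\ off = 4).

Lemma fdart_off l : l < 4 -> fdart (off + l) = corner c (lcor dir c l).
Proof.
by move=> l4; rewrite /fdart; case: offP => -[-> ->]; rewrite ?l4 // ltnNge leq_addr addKn.
Qed.

Lemma off_lt l : l < 4 -> off + l < 8.
Proof. by case: offP => -[_ ->]; lia. Qed.

Lemma smo_off (t : state) l : l < 4 -> smo t (off + l) = off + smooth4 (t c) l.
Proof.
move=> l4; rewrite /smooth; case: offP => -[-> ->]; first by rewrite l4.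
by rewrite ltnNge leq_addr addKn.
Qed.

Lemma Q_smo (t : state) l : l < 8 -> Q t (smo t l) = Q t l.
Proof. by move=> l8; rewrite !QE; apply/esym/pos_circ/circ_smooth. Qed.

Lemma edge_Q : [/\ Q s (off + 1) = Q s off, Q s (off + 2) = Q s (off + 3),
                  Q s' (off + 2) = Q s' off & Q s' (off + 1) = Q s' (off + 3)].
Proof.
have := @Q_smo s (off + 0) (@off_lt 0 isT); rewrite smo_off // sc addn0 => ->.
have := @Q_smo s (off + 3) (@off_lt 3 isT); rewrite smo_off // sc => ->.
have := @Q_smo s' (off + 0) (@off_lt 0 isT); rewrite smo_off // sc' addn0 => ->.
by have := @Q_smo s' (off + 3) (@off_lt 3 isT); rewrite smo_off // sc' => ->.
Qed.

Lemma edge_rt : let r t l := rt (LS t) (off + l) in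
  [/\ r s 1 = r s 0, r s 2 = r s 3, r s' 2 = r s' 0 & r s' 1 = r s' 3].
Proof.
have smoR (t : state) l : l < 4 -> rt (LS t) (off + smooth4 (t c) l) = rt (LS t) (off + l).
  by move=> l4; rewrite -smo_off //; have [_ _ _ -> _] := ok_LS t (off_lt l4).
split; [have := smoR s 0 isT|have := smoR s 3 isT|have := smoR s' 0 isT|have := smoR s' 3 isT];
  by rewrite ?sc ?sc'.
Qed.

Definition corner_pts := [:: NW dir c; NE dir c; SW dir c; SE dir c].

(** Either smoothing joins the labels 1 and 2 to 0 and 3, so the circles through 0 and 3 account for
    all four corners. *)
Lemma undup_pos (t : state) : t = s \/ t = s' ->
  undup [seq pos e t v | v <- corner_pts] = pair2 (Q t off) (Q t (off + 3)).
Proof.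
have [E1 E2 E3 E4] := edge_Q; have [nw se [k1 [k2 [kk ne sw _ _]]]] := corners_spec c.
rewrite /corner_pts nw ne sw se => tE.
have LQ l : l < 4 -> pos e t (corner c (lcor dir c l)).1 = Q t (off + l).
  by move=> l4; rewrite /Q fdart_off.
have undup4 (a b : nat) : undup [:: a; a; b; b] = pair2 a b /\ undup [:: a; b; a; b] = pair2 a b.
  rewrite /pair2 /= !inE !eqxx (eq_sym b a) !orbT /=; case: (altP eqP) => [->|] /=;
  by rewrite ?inE ?eqxx //= ?inE; split=> //; case: eqP.
have [u1 u2] := undup4 (Q t off) (Q t (off + 3)).
rewrite /= (LQ 0) // (LQ 3) // addn0.
by case: kk tE => -[-> ->]; rewrite (LQ 1) // (LQ 2) // => -[] tE; move: LQ u1 u2;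
  rewrite tE ?E1 ?E2 ?E3 ?E4 => LQ u1 u2; rewrite ?u1 ?u2.
Qed.

Lemma size_pair2 a b : (size (pair2 a b) == 2) = (a != b).
Proof. by rewrite /pair2; case: (a =P b). Qed.

Lemma size_pair1 a b : (size (pair2 a b) == 1) = (a == b).
Proof. by rewrite /pair2; case: (a =P b). Qed.

Lemma other_pair2 a b : head a [seq p <- pair2 a b | p != a] = b.
Proof. by rewrite /pair2; case: (a =P b) => [->|/eqP nab] /=; rewrite eqxx //= eq_sym nab. Qed.

Lemma pair2E a b : (if a != b then [:: a; b] else [:: a]) = pair2 a b.
Proof. by rewrite /pair2; case: (a =P b). Qed.

Definition tau (j : nat) : nat := pos e s' (np (rep e s j)).
Definition agree (j : nat) : bool :=
  [forall v : node, circ s (rep e s j) v ==> (o s (np v) == o s' (np v))].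

(** The left arc and the top arc both contain the north-west corner, so the first circle is the one
    through label 0 for either sign. *)
Lemma coefE (x : basis e s) (y : basis e s') :
  let a0 := Q s off in let a3 := Q s (off + 3) in
  let b0 := Q s' off in let b3 := Q s' (off + 3) in
  let R0 := [seq j <- iota 0 (size (e s)) | j \notin pair2 a0 a3] in
  coef dir o c x y =
  (if all (fun j => lab y (tau j) == lab x j) R0 then
     sgn (pair2 a0 a3 ++ R0) * sgn (pair2 b0 b3 ++ map tau R0)
     * \prod_(j <- R0 | lab x j) (if agree j then 1 else -1)
     * (if (a0 != a3) && (b0 == b3) then
         if mcoef (proj s (rep e s a0)) (proj s (rep e s a3)) (lab x a0) (lab x a3) (lab y b0)
         then fac (lab x a0) (eps dir e o c s a0) * fac (lab x a3) (eps dir e o c s a3)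
              * fac (lab y b0) (eps dir e o c s' b0)
         else 0
       else if (a0 == a3) && (b0 != b3) then
         if dcoef (proj s' (rep e s' b0)) (proj s' (rep e s' b3)) (lab x a0) (lab y b0) (lab y b3)
         then fac (lab x a0) (eps dir e o c s a0) * fac (lab y b0) (eps dir e o c s' b0)
              * fac (lab y b3) (eps dir e o c s' b3)
         else 0
       else 0)
   else 0)%R.
Proof.
move=> a0 a3 b0 b3 R0; rewrite /coef; cbv zeta; rewrite -/corner_pts !undup_pos; [|by right|by left].
have [nw _ _] := corners_spec c.
have first_pos (t : state) : pos e t (if positive dir c then left_pt dir c else top_pt dir c) = Q t off.
  by rewrite /left_pt /top_pt if_same nw /Q -[off]addn0 fdart_off.
by rewrite !first_pos !other_pair2 !size_pair2 !size_pair1 !pair2E.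
Qed.

(** Under the coherence condition the chosen orientation and the reference one give consistency
    signs that differ exactly by their comparison at the root. *)
Lemma epsE (t : state) l : fam t -> l < 8 -> eps_ok off (LS t) (rt (LS t) l) ->
  eps dir e o c t (Q t l) = (leps (LS t) off (rt (LS t) l) * sg (hin t (rt (LS t) l)))%R.
Proof.
move=> ft l8 /andP[b12 bp].
have [o1 o2] : off + 1 < 8 /\ off + 2 < 8 by split; apply: off_lt.
have CE k : k < 8 -> circ t (rep e t (Q t l)) (fn k) = (rt (LS t) k == rt (LS t) l).
  by move=> k8; rewrite QE circ_repQ ?valid_fn // circ_rt // eq_sym.
have [_ _ [k1 [k2 [kk ne sw dne dsw]]]] := corners_spec c.
have [k14 k24] : k1 < 4 /\ k2 < 4 by case: kk => -[-> ->].
have neE : nd (NE dir c) = fn (off + k1) by rewrite /fn fdart_off // ne.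
have swE : nd (SW dir c) = fn (off + k2) by rewrite /fn fdart_off // sw.
have oNE : (o t (NE dir c) == dir (NE dir c)) = ~~ hin t (off + k1).
  rewrite dne /hin fdart_off // ne; by case: (o t _); case: (corner _ _).2.
have oSW : (o t (SW dir c) != dir (SW dir c)) = ~~ hin t (off + k2).
  by rewrite dsw /hin fdart_off // sw.
rewrite /eps neE swE !CE ?off_lt // oNE oSW.
have -> : ((rt (LS t) (off + k1) == rt (LS t) l) && ~~ hin t (off + k1))
      || ((rt (LS t) (off + k2) == rt (LS t) l) && ~~ hin t (off + k2))
   = ((rt (LS t) (off + 1) == rt (LS t) l) && ~~ hin t (off + 1))
      || ((rt (LS t) (off + 2) == rt (LS t) l) && ~~ hin t (off + 2)).
  by case: kk => -[-> ->] //; rewrite orbC.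
have hk k : k < 8 -> (rt (LS t) k == rt (LS t) l) && ~~ hin t k =
    (rt (LS t) k == rt (LS t) l) && ~~ (hin t (rt (LS t) l) (+) nth false (lpar (LS t)) k).
  by move=> k8; case: (rt (LS t) k =P rt (LS t) l) => [E|_]; rewrite // -E -(hin_rt ft k8).
rewrite !hk // /leps; move: b12 bp.
move: (rt _ (off + 1) == _) (rt _ (off + 2) == _) (nth _ _ (off + 1)) (nth _ _ (off + 2)) (hin _ _).
by case; case; case; case; case.
Qed.

Local Notation A := (LS s).
Local Notation B := (LS s').
(** Circles that meet the other crossing of the face but not [c]. *)
Definition Rs : seq nat := [seq r <- lT A | r \notin pair2 (rt A off) (rt A (off + 3))].

Lemma off0_lt : off < 8.
Proof. by rewrite -[off]addn0 off_lt. Qed.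

Lemma smo_other l : l < 8 -> ~~ (off <= l < off + 4) -> smo s l = smo s' l.
Proof.
move=> l8; rewrite /smooth; case: offP => -[E ->].
  rewrite add0n /= => /negbTE->; congr (_ + smooth4 _ _).
  by rewrite ss' // E eq_sym.
have -> : s c1 = s' c1 by apply: ss'; rewrite E.
by case: (ltnP l 4) => // _ /negP nl; case: nl; apply/andP; split.
Qed.

Lemma untouched r x b : r \in Rs -> circ s (fn r) x -> nmate s (x, b) = nmate s' (x, b).
Proof.
rewrite mem_filter => /andP[rN /lT_lt[r8 rr]] cx.
case: (boolP ((x, b) \in labs)) => [/labsP[l l8 E]|xN]; last by rewrite !nmate_fam.
rewrite E !nmate_lab // smo_other //; apply/negP => /andP[l1 l2].
have E' : x = fn l by case: (congr1 fst E).
move: cx; rewrite E' circ_rt // rr => /eqP rl; move: rN; rewrite rl.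
have [k k4 ->] : exists2 k, k < 4 & l = off + k by exists (l - off); lia.
have [e1 e2 _ _] := edge_rt; rewrite addn0 in e1.
rewrite /pair2; case: k k4 => [|[|[|[|]]]] // _; rewrite ?addn0 ?e1 ?e2;
  by case: eqP => [->|_]; rewrite !inE eqxx ?orbT.
Qed.

Lemma Rs_lT r : r \in Rs -> r \in lT A.
Proof. by rewrite mem_filter => /andP[]. Qed.

Lemma tau_Q r : r \in Rs -> tau (Q s r) = Q s' r.
Proof.
move=> rR; have vr := valid_fn r; rewrite [RHS]QE /tau; apply: pos_circ.
rewrite (circ_sym wfw); have [<- _] := same_circle vr (fun x b => untouched b rR) (rep e s (Q s r)).
by rewrite (circ_sym wfw) QE circ_repQ // (circ_refl wfw).
Qed.

Lemma spec_same j x b : j \in spec -> circ s (sp j) x -> nmate s (x, b) = nmate s' (x, b).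
Proof.
move=> js cx; rewrite (spec_nmate b fs js cx); symmetry; apply: (spec_nmate b fs' js).
have [-> _] := spec_circle x fs' js; by have [<- _] := spec_circle x fs js.
Qed.

Lemma tau_sigma j : j \in spec -> tau (sigma s j) = sigma s' j.
Proof.
move=> js; have vj := valid_sp js; rewrite /tau /sigma; apply: pos_circ.
rewrite (circ_sym wfw); have [<- _] := same_circle vj (fun x b => spec_same b js) (rep e s (sigma s j)).
by rewrite (circ_sym wfw) circ_repQ // (circ_refl wfw).
Qed.

Lemma agreeE (u : node) : valid_node u ->
    (forall x b, circ s u x -> nmate s (x, b) = nmate s' (x, b)) ->
  agree (pos e s (np u)) = (o s (np u) == o s' (np u)).
Proof.
move=> vu same; apply/forallP/idP => [/(_ u)|ou v].
  by rewrite circ_repQ // (circ_refl wfw).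
rewrite circ_repQ //; apply/implyP => uv.
by have [_ ->] := same_circle vu same v.
Qed.

Lemma agree_Q r : r \in Rs -> agree (Q s r) = (hin s r == hin s' r).
Proof.
move=> rR; rewrite {1}QE (agreeE (valid_fn r) (fun x b => untouched b rR)) np_fn /hin.
by case: (o s _); case: (o s' _); case: (fdart r).2.
Qed.

Lemma agree_sigma j : j \in spec -> agree (sigma s j) = (o s (np (sp j)) == o s' (np (sp j))).
Proof. by move=> js; rewrite (agreeE (valid_sp js) (fun x b => spec_same b js)). Qed.

Lemma rest_perm :
  perm_eq [seq j <- iota 0 (size (e s)) | j \notin pair2 (Q s off) (Q s (off + 3))]
          (map (Q s) Rs ++ map (sigma s) spec).
Proof.
rewrite (perm_trans (perm_filter _ (positions_perm fs))) // filter_cat.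
have o0 := off0_lt; have o3 : off + 3 < 8 by apply: off_lt.
have -> : [seq j <- map (sigma s) spec | j \notin pair2 (Q s off) (Q s (off + 3))]
   = map (sigma s) spec.
  apply/all_filterP/allP => _ /mapP[j js ->].
  by rewrite /pair2; case: ifP => _; rewrite !inE ?sigma_neq.
rewrite filter_map; have -> : [seq r <- lT A | preim (Q s)
    (fun j => j \notin pair2 (Q s off) (Q s (off + 3))) r] = Rs; last exact: perm_refl.
apply: eq_in_filter => r /lT_lt[r8 rr] /=; congr (~~ _).
by rewrite /pair2 Q_eq //; case: ifP => _; rewrite !inE !Q_eq // rr.
Qed.

Lemma map_tau_rest :
  map tau (map (Q s) Rs ++ map (sigma s) spec) = map (Q s') (map (rt B) Rs) ++ map (sigma s') spec.
Proof.
rewrite map_cat -!map_comp; congr (_ ++ _); apply/eq_in_map => j jR /=; last exact: tau_sigma.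
by have [r8 _] := lT_lt (Rs_lT jR); rewrite tau_Q // Q_rt.
Qed.

Lemma fac_mul (a : bool) u v : fac a (u * v)%R = (fac a u * fac a v)%R.
Proof. by case: a; rewrite //= mulr1. Qed.

(* Gauge weight of a labelled state: the sign changes needed to pass from the chosen
   orientations of the circles to those pointing out of the canonical corners. *)
Definition local_weight (t : state) (x : basis e t) (T : seq nat) : int :=
  (\prod_(r <- T) fac (lab x (Q t r)) (sg (hin t r)))%R.
Definition spec_weight (t : state) (x : basis e t) : int :=
  (\prod_(j <- spec) fac (lab x (sigma t j)) (sg (o t (np (sp j)))))%R.
Definition weight (t : state) (x : basis e t) : int :=
  (sgn (positions t) * local_weight x (lT (LS t)) * spec_weight x)%R.
Definition spec_match (t t' : state) (x : basis e t) (y : basis e t') : bool :=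
  all (fun j => lab y (sigma t' j) == lab x (sigma t j)) spec.

Lemma pair2_map (f : nat -> nat) a b : (f a == f b) = (a == b) ->
  pair2 (f a) (f b) = map f (pair2 a b).
Proof. by rewrite /pair2 => ->; case: eqP. Qed.

Lemma sgn_positions (t : state) (l : seq nat) : fam t -> perm_eq (lT (LS t)) l ->
  sgn (map (Q t) l ++ map (sigma t) spec) = (sgn (positions t) * (sgn l * sgn (lT (LS t))))%R.
Proof.
move=> ft pl; have := sgn_map_perm [::] [::] (map (sigma t) spec) [::] (lT_uniq t) pl
  (Q_inj ft) (fun x y _ _ => id : id x = id y -> x = y).
rewrite !cat0s !cats0 !map_id => E.
rewrite -/(positions t) in E.
rewrite -[LHS]mulr1 -(sgn_sqr l) [LHS]mulrA -E.
by rewrite mulrAC -mulrA.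
Qed.

Lemma ok_edge_LS : ok_edge off A B.
Proof.
have [_ ok0 ok4 _] := ok_squareP face_ok.
rewrite /LS; case: offP => -[E Eo]; rewrite Eo.
  have -> : s c2 = s' c2 by apply: ss'; rewrite E eq_sym.
  by move: sc sc'; rewrite E => -> ->; apply: ok0.
have -> : s c1 = s' c1 by apply: ss'; rewrite E.
by move: sc sc'; rewrite E => -> ->; apply: ok4.
Qed.

(** The uninvolved circles may be relisted simultaneously in both states. With the touched ones
    first, both orders differ from [positions] only by a permutation of the touched circles. *)
Lemma sgn_edge :
  let R0 := [seq j <- iota 0 (size (e s)) | j \notin pair2 (Q s off) (Q s (off + 3))] in
  let P := pair2 (rt A off) (rt A (off + 3)) in
  let P' := pair2 (rt B off) (rt B (off + 3)) in
  (sgn (pair2 (Q s off) (Q s (off + 3)) ++ R0)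
   * sgn (pair2 (Q s' off) (Q s' (off + 3)) ++ map tau R0) =
   sgn (positions s) * sgn (positions s')
   * (sgn (P ++ Rs) * sgn (lT A) * (sgn (P' ++ map (rt B) Rs) * sgn (lT B))))%R.
Proof.
move=> R0 P P'; have /and3P[pA' pB' _] := ok_edge_LS.
have pA : perm_eq (lT A) (P ++ Rs) := pA'.
have pB : perm_eq (lT B) (P' ++ map (rt B) Rs) := pB'.
clear pA' pB'.
have o0 := off0_lt; have o3 : off + 3 < 8 by apply: off_lt.
have pairQ (t : state) : fam t -> pair2 (Q t off) (Q t (off + 3)) =
    map (Q t) (pair2 (rt (LS t) off) (rt (LS t) (off + 3))).
  move=> ft; rewrite -(Q_rt ft o0) -(Q_rt ft o3); apply: pair2_map.
  have [l1 r1 _ _ _] := ok_LS t o0; have [l3 r3 _ _ _] := ok_LS t o3.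
  by rewrite Q_eq // r1 r3.
have uR0 : uniq R0 by rewrite filter_uniq // iota_uniq.
have pR0 : perm_eq R0 (map (Q s) Rs ++ map (sigma s) spec) := rest_perm.
have uB : uniq (map (Q s') (map (rt B) Rs) ++ map (sigma s') spec).
  have := positions_uniq fs'; rewrite /positions.
  have pB' : perm_eq (map (Q s') (lT B) ++ map (sigma s') spec)
     (map (Q s') P' ++ (map (Q s') (map (rt B) Rs) ++ map (sigma s') spec)).
    by rewrite catA -map_cat perm_cat2r perm_map.
  by rewrite (perm_uniq pB') cat_uniq => /and3P[].
have tau_inj : {in R0 &, injective tau}.
  have: uniq (map tau R0) by rewrite (perm_uniq (perm_map tau pR0)) map_tau_rest.
  move=> ut i j iR jR E; move: (nth_index 0 iR) (nth_index 0 jR) => <- <-.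
  congr (nth 0 R0 _); apply/eqP; rewrite -(nth_uniq 0 _ _ ut) ?size_map ?index_mem //.
  by rewrite !(nth_map 0) ?index_mem // !nth_index // E.
have := sgn_map_perm (pair2 (Q s off) (Q s (off + 3))) (pair2 (Q s' off) (Q s' (off + 3)))
  [::] [::] uR0 pR0 (fun x y _ _ => id : id x = id y -> x = y) tau_inj.
rewrite !map_id !cats0 => ->; rewrite map_tau_rest !pairQ // !catA -!map_cat.
rewrite (sgn_positions fs pA) (sgn_positions fs' pB).
exact: mulrACA.
Qed.

(** Stated for bare scalars so that [ring] applies. Each primed generator carries a consistency sign
    that splits into a reference sign and the gauge sign of its circle; when the number of circles
    does not change, both sides vanish. *)
Lemma phi_gauge (a0 a3 b0 b3 ra0 ra3 rb0 rb3 : nat)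
    (la0 la3 lb0 lb3 la0' la3' lb0' lb3' pa0 pa3 pb0 pb3 pa0' pa3' pb0' pb3' : bool)
    (ea0 ea3 eb0 eb3 fa0 fa3 fb0 fb3 ha0 ha3 hb0 hb3 W W' : int) :
    (a0 == a3) = (ra0 == ra3) -> (b0 == b3) = (rb0 == rb3) ->
    [/\ la0' = la0, la3' = la3, lb0' = lb0 & lb3' = lb3] ->
    [/\ pa0 = pa0', pa3 = pa3', pb0 = pb0' & pb3 = pb3'] ->
    ((ra0 == ra3) != (rb0 == rb3) ->
      [/\ ea0 = fa0 * ha0, ea3 = fa3 * ha3, eb0 = fb0 * hb0 & eb3 = fb3 * hb3]%R) ->
    W = (if ra0 == ra3 then fac la0 ha0 else fac la0 ha0 * fac la3 ha3)%R ->
    W' = (if rb0 == rb3 then fac lb0 hb0 else fac lb0 hb0 * fac lb3 hb3)%R ->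
  ((if (a0 != a3) && (b0 == b3) then
      if mcoef pa0 pa3 la0 la3 lb0 then fac la0 ea0 * fac la3 ea3 * fac lb0 eb0 else 0
    else if (a0 == a3) && (b0 != b3) then
      if dcoef pb0 pb3 la0 lb0 lb3 then fac la0 ea0 * fac lb0 eb0 * fac lb3 eb3 else 0
    else 0) =
   W * W' *
   (if (ra0 != ra3) && (rb0 == rb3) then
      if mcoef pa0' pa3' la0' la3' lb0' then fac la0' fa0 * fac la3' fa3 * fac lb0' fb0 else 0
    else if (ra0 == ra3) && (rb0 != rb3) then
      if dcoef pb0' pb3' la0' lb0' lb3' then fac la0' fa0 * fac lb0' fb0 * fac lb3' fb3 else 0
    else 0))%R.
Proof.
move=> -> -> [-> -> -> ->] [-> -> -> ->] + -> ->.
case: (ra0 == ra3); case: (rb0 == rb3) => /= E; rewrite ?mulr0 //; have [] := E isT.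
  by move=> -> _ -> ->; case: ifP => _; rewrite ?mulr0 // !fac_mul; ring.
by move=> -> -> -> _; case: ifP => _; rewrite ?mulr0 // !fac_mul; ring.
Qed.

Lemma local_weight_pair (t : state) (z : basis e t) l l' : fam t -> l < 8 -> l' < 8 ->
  local_weight z (pair2 (rt (LS t) l) (rt (LS t) l')) =
  (if rt (LS t) l == rt (LS t) l' then fac (lab z (Q t l)) (sg (hin t (rt (LS t) l)))
   else fac (lab z (Q t l)) (sg (hin t (rt (LS t) l)))
      * fac (lab z (Q t l')) (sg (hin t (rt (LS t) l'))))%R.
Proof.
move=> ft l8 l8'; rewrite /local_weight /pair2 -(Q_rt ft l8) -(Q_rt ft l8').
by case: eqP => _; rewrite !big_cons big_nil mulr1.
Qed.

Lemma phi_edge (x : basis e s) (y : basis e s') :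
  let a0 := Q s off in let a3 := Q s (off + 3) in
  let b0 := Q s' off in let b3 := Q s' (off + 3) in
  let X := loc x in let Y := loc y in
  ((if (a0 != a3) && (b0 == b3) then
         if mcoef (proj s (rep e s a0)) (proj s (rep e s a3)) (lab x a0) (lab x a3) (lab y b0)
         then fac (lab x a0) (eps dir e o c s a0) * fac (lab x a3) (eps dir e o c s a3)
              * fac (lab y b0) (eps dir e o c s' b0)
         else 0
       else if (a0 == a3) && (b0 != b3) then
         if dcoef (proj s' (rep e s' b0)) (proj s' (rep e s' b3)) (lab x a0) (lab y b0) (lab y b3)
         then fac (lab x a0) (eps dir e o c s a0) * fac (lab y b0) (eps dir e o c s' b0)
              * fac (lab y b3) (eps dir e o c s' b3)
         else 0
       else 0) =
  local_weight x (pair2 (rt A off) (rt A (off + 3))) *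
  local_weight y (pair2 (rt B off) (rt B (off + 3))) *
  (let a0 := rt A off in let a3 := rt A (off + 3) in
   let b0 := rt B off in let b3 := rt B (off + 3) in
   if (a0 != a3) && (b0 == b3) then
     if mcoef (nth false (lproj A) a0) (nth false (lproj A) a3)
              (llab A X off) (llab A X (off + 3)) (llab B Y off)
     then fac (llab A X off) (leps A off a0) * fac (llab A X (off + 3)) (leps A off a3)
          * fac (llab B Y off) (leps B off b0)
     else 0
   else if (a0 == a3) && (b0 != b3) then
     if dcoef (nth false (lproj B) b0) (nth false (lproj B) b3)
              (llab A X off) (llab B Y off) (llab B Y (off + 3))
     then fac (llab A X off) (leps A off a0) * fac (llab B Y off) (leps B off b0)
          * fac (llab B Y (off + 3)) (leps B off b3)
     else 0
   else 0))%R.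
Proof.
have /and3P[_ _ /implyP coh] := ok_edge_LS.
have o0 := off0_lt; have o3 : off + 3 < 8 by apply: off_lt.
apply: phi_gauge.
- exact: Q_eq.
- exact: Q_eq.
- by split; apply: llabE.
- by split; apply: proj_Q.
- by move=> /coh/and4P[k1 k2 k3 k4]; split; apply: epsE.
- exact: local_weight_pair.
- exact: local_weight_pair.
Qed.

Lemma all_rest (x : basis e s) (y : basis e s') :
  all (fun j => lab y (tau j) == lab x j)
    [seq j <- iota 0 (size (e s)) | j \notin pair2 (Q s off) (Q s (off + 3))] =
  all (fun r => llab B (loc y) r == llab A (loc x) r) Rs && spec_match x y.
Proof.
rewrite (perm_all _ rest_perm) all_cat !all_map; congr (_ && _).
  apply: eq_in_all => r rR; have [r8 _] := lT_lt (Rs_lT rR).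
  by rewrite [LHS]/= tau_Q // llabE // llabE.
by apply: eq_in_all => j js; rewrite [LHS]/= tau_sigma.
Qed.

(** The sign acquired by an uninvolved circle is the product of its gauge signs in the two states.
    For a touched circle the reference corner may differ between the states, which [lpar]
    corrects. *)
Lemma prod_rest (x : basis e s) (y : basis e s') :
    all (fun r => llab B (loc y) r == llab A (loc x) r) Rs -> spec_match x y ->
  (\prod_(j <- [seq j <- iota 0 (size (e s)) | j \notin pair2 (Q s off) (Q s (off + 3))]
      | lab x j) (if agree j then 1 else -1) =
   local_weight x Rs * local_weight y (map (rt B) Rs) *
   (foldr *%R 1 [seq (if llab A (loc x) r then sg (nth false (lpar B) r) else 1) | r <- Rs]) *
   (spec_weight x * spec_weight y))%R.
Proof.
move=> /allP mR /allP mS.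
rewrite big_mkcond (perm_big _ rest_perm) big_cat !big_map; congr (_ * _)%R; last first.
  rewrite -big_split big_seq [RHS]big_seq; apply: eq_bigr => j js.
  move: (mS j js) => /eqP ->; rewrite agree_sigma //.
  by case: (lab x _) => //=; case: (o s _); case: (o s' _).
rewrite foldrE big_map /local_weight big_map -!big_split big_seq [RHS]big_seq.
apply: eq_bigr => r rR; have [r8 _] := lT_lt (Rs_lT rR).
move: (mR r rR); rewrite (llabE x fs r8) (llabE y fs' r8) => /eqP yx.
rewrite agree_Q // (Q_rt fs' r8) yx (hin_rt fs' r8).
move: (lab x _) (hin s r) (hin s' _) (nth _ _ _).
by case; case; case; case.
Qed.

Lemma weight_assembly (SG PR PHI SGl F PHIl p p' u u' v v' g g' Wx Wy : int) :
  (SG = p * p' * SGl -> PR = u * u' * F * (v * v') -> PHI = g * g' * PHIl ->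
   Wx = p * (g * u) * v -> Wy = p' * (g' * u') * v' ->
   SG * PR * PHI = Wx * Wy * (SGl * F * PHIl))%R.
Proof. by move=> -> -> -> -> ->; ring. Qed.

Lemma local_weight_cat (t : state) (z : basis e t) l l1 l2 :
  perm_eq l (l1 ++ l2) -> local_weight z l = (local_weight z l1 * local_weight z l2)%R.
Proof. by move=> pl; rewrite /local_weight (perm_big _ pl) big_cat. Qed.

(** The order of the factors, the uninvolved circles and the bifurcation each split off their gauge
    signs; together these form the two weights, which absorb all arbitrary choices. *)
Lemma coef_local (x : basis e s) (y : basis e s') :
  coef dir o c x y = (weight x * weight y *
    (if spec_match x y then lcoef off A B (loc x) (loc y) else 0))%R.
Proof.
rewrite coefE all_rest; case mS: (spec_match x y); last by rewrite andbF mulr0.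
rewrite andbT /lcoef -/Rs; case mR: (all _ Rs); last by rewrite mulr0.
have /and3P[pA pB _] := ok_edge_LS.
apply: weight_assembly.
- exact: sgn_edge.
- exact: (prod_rest mR mS).
- exact: phi_edge.
- by rewrite /weight (local_weight_cat x pA).
- by rewrite /weight (local_weight_cat y pB).
Qed.

End Edge.

(** * Two consecutive edges, and the face *)

Lemma lab_ord n (x : {ffun 'I_n -> bool}) (j : 'I_n) : lab x j = x j.
Proof. by rewrite /lab valK. Qed.

Lemma weight_sqr (t : state) (z : basis e t) : (weight z * weight z = 1)%R.
Proof.
have prod_sqr (I : Type) (r : seq I) (a b : I -> bool) :
    ((\prod_(i <- r) fac (a i) (sg (b i))) * (\prod_(i <- r) fac (a i) (sg (b i))) = 1)%R.
  by rewrite -big_split big1 // => i _ /=; case: (a i); case: (b i).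
rewrite /weight; have := sgn_sqr (positions t).
have := prod_sqr _ (lT (LS t)) (fun r => lab z (Q t r)) (hin t).
have := prod_sqr _ spec (fun j => lab z (sigma t j)) (fun j => o t (np (sp j))).
rewrite -/(spec_weight z) -/(local_weight z (lT (LS t))).
move: (spec_weight z) (local_weight z _) (sgn _) => a b d Ea Eb Ed.
have -> : (d * b * a * (d * b * a) = (d * d) * (b * b) * (a * a))%R by ring.
by rewrite Ea Eb Ed.
Qed.

(** A labelling of [t] that agrees with [x] on the spectators is determined by its labels on the
    touched circles, and these are arbitrary. *)
Lemma sum_loc (s t : state) (x : basis e s) (G : bitseq -> int) : fam t ->
  (\sum_(z : basis e t) (if spec_match x z then G (loc z) else 0) =
   foldr +%R 0 [seq G Z | Z <- bitseqs (size (lT (LS t)))])%R.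
Proof.
move=> ft; rewrite foldrE big_map; set T := lT (LS t).
have uT : uniq T := lT_uniq t.
have idxQ r : r \in T -> index (Q t r) (map (Q t) T) = index r T.
  move=> rT; have iT : index r T < size (map (Q t) T) by rewrite size_map index_mem.
  rewrite -{1}(nth_index 0 rT) -(nth_map 0 0) ?index_mem // index_uniq //.
  by rewrite (map_inj_in_uniq (Q_inj ft)).
have idxS j : j \in spec -> index (sigma t j) (map (sigma t) spec) = index j spec.
  move=> jS; have iS : index j spec < size (map (sigma t) spec) by rewrite size_map index_mem.
  rewrite -{1}(nth_index 0 jS) -(nth_map 0 0) ?index_mem // index_uniq //.
  by rewrite (map_inj_in_uniq (sigma_inj ft)) filter_uniq // iota_uniq.
have unique Z : size Z = size T -> exists z0 : basis e t,
    forall z : basis e t, spec_match x z && (loc z == Z) = (z == z0).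
  (* The labelling with touched part [Z] and spectator part taken from [x], as a function of the
     position. *)
  move=> sZ; pose g p := if p \in map (Q t) T then nth false Z (index p (map (Q t) T))
    else lab x (sigma s (nth 0 spec (index p (map (sigma t) spec)))).
  have gQ r : r \in T -> g (Q t r) = nth false Z (index r T).
    by move=> rT; rewrite /g map_f // idxQ.
  have gS j : j \in spec -> g (sigma t j) = lab x (sigma s j).
    move=> jS; rewrite /g idxS // nth_index //; case: mapP => // -[r /lT_lt[r8 _] /eqP].
    by rewrite sigma_neq.
  exists [ffun j : 'I_(size (e t)) => g j] => z.
  apply/andP/eqP => [[/allP mz /eqP zZ]|->].
    apply/ffunP => j; rewrite ffunE -lab_ord.
    have : (j : nat) \in positions t by rewrite -(perm_mem (positions_perm ft)) mem_iota /=.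
    rewrite mem_cat => /orP[] /mapP[k kT ->].
      by rewrite gQ // -zZ /loc (nth_map 0) ?index_mem // nth_index.
    by rewrite gS //; apply/eqP/mz.
  have lg p : p < size (e t) -> lab [ffun j : 'I_(size (e t)) => g j] p = g p.
    by move=> pt; rewrite -[p]/(val (Ordinal pt)) lab_ord ffunE.
  split; first by apply/allP => j jS; rewrite lg ?sigma_lt // gS.
  apply/eqP; apply: (@eq_from_nth _ false); first by rewrite size_map sZ.
  move=> k; rewrite size_map => kT; rewrite (nth_map 0) // lg ?Q_lt // gQ ?mem_nth //.
  by rewrite index_uniq.
transitivity (\sum_(z : basis e t) \sum_(Z <- bitseqs (size T))
    (if spec_match x z && (loc z == Z) then G Z else 0))%R.
  apply: eq_bigr => z _; case: (spec_match x z); last by rewrite big1.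
  have lz : loc z \in bitseqs (size T) by rewrite mem_bitseqs size_map.
  move: (loc z) (bitseqs (size T)) (bitseqs_uniq (size T)) lz => l bs ubs lbs.
  rewrite (bigD1_seq l) //= eqxx big1 ?addr0 // => Z.
  by rewrite eq_sym => /negbTE ->.
rewrite exchange_big big_seq [RHS]big_seq; apply: eq_bigr => Z.
rewrite mem_bitseqs => /eqP sZ; have [z0 zP] := unique Z sZ.
by under eq_bigr do rewrite zP; rewrite -big_mkcond big_pred1_eq.
Qed.

(** The weight of the intermediate labelling occurs twice and squares to 1, and the spectator
    conditions compose, so only the weights of the two ends survive. *)
Lemma sum_coef (c c' : crossing w) (off off' : nat) (s t s' : state)
    (x : basis e s) (y : basis e s') : fam s -> fam t -> fam s' ->
    s c = false -> t c = true -> (forall d, d != c -> s d = t d) ->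
    (c = c1 /\ off = 0) \/ (c = c2 /\ off = 4) ->
    t c' = false -> s' c' = true -> (forall d, d != c' -> t d = s' d) ->
    (c' = c1 /\ off' = 0) \/ (c' = c2 /\ off' = 4) ->
  (\sum_(z : basis e t) coef dir o c x z * coef dir o c' z y = weight x * weight y *
   (if spec_match x y then lpath off off' (LS s) (LS t) (LS s') (loc x) (loc y) else 0))%R.
Proof.
move=> fs ft fs' sc tc st offc tc' sc' ts' offc'.
pose G Z := (lcoef off (LS s) (LS t) (loc x) Z * lcoef off' (LS t) (LS s') Z (loc y))%R.
transitivity (\sum_(z : basis e t) weight x * weight y * (if spec_match x y then
   (if spec_match x z then G (loc z) else 0) else 0))%R; last first.
  rewrite -mulr_sumr; congr (_ * _)%R; case: (spec_match x y); last by rewrite big1.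
  exact: sum_loc.
apply: eq_bigr => z _.
rewrite (coef_local fs ft sc tc st offc) (coef_local ft fs' tc' sc' ts' offc') /G.
have [mz|mz] := boolP (spec_match x z); last by rewrite mulr0 mul0r if_same mulr0.
have -> : spec_match z y = spec_match x y.
  apply: eq_in_all => j jS; by move/allP: mz => /(_ j jS)/eqP->.
case: (spec_match x y); last by rewrite !mulr0.
have := weight_sqr z; move: (weight z) (weight x) (weight y) (lcoef _ _ _ _ _) (lcoef _ _ _ _ _).
move=> wz wx wy l2 l1 wz1.
have -> : (wx * wz * l1 * (wz * wy * l2) = (wz * wz) * (wx * wy * (l1 * l2)))%R by ring.
by rewrite wz1 mul1r.
Qed.

(** Both paths have the same end weights and the same spectator condition, which factor out; what is
    left is an instance of the finite verification. *)
Lemma face_sum (s00 s10 s01 s11 : state) (x : basis e s00) (y : basis e s11) :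
    fam s00 -> fam s10 -> fam s01 -> fam s11 ->
    s00 c1 = false -> s00 c2 = false -> s10 c1 = true -> s10 c2 = false ->
    s01 c1 = false -> s01 c2 = true -> s11 c1 = true -> s11 c2 = true ->
  (\sum_(z : basis e s10) coef dir o c1 x z * coef dir o c2 z y
   + \sum_(z : basis e s01) coef dir o c2 x z * coef dir o c1 z y = 0)%R.
Proof.
move=> f00 f10 f01 f11 b1 b2 b3 b4 b5 b6 b7 b8.
have same1 (t t' : state) : fam t -> fam t' -> t c2 = t' c2 ->
    forall d, d != c1 -> t d = t' d.
  move=> ft ft' E d d1; case: (eqVneq d c2) => [->//|d2].
  by rewrite ft // ft'.
have same2 (t t' : state) : fam t -> fam t' -> t c1 = t' c1 ->
    forall d, d != c2 -> t d = t' d.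
  move=> ft ft' E d d2; case: (eqVneq d c1) => [->//|d1].
  by rewrite ft // ft'.
have off1 : (c1 = c1 /\ 0 = 0) \/ (c1 = c2 /\ 0 = 4) by left.
have off2 : (c2 = c1 /\ 4 = 0) \/ (c2 = c2 /\ 4 = 4) by right.
rewrite (sum_coef _ _ f00 f10 f11 b1 b3 (same1 _ _ f00 f10 (etrans b2 (esym b4))) off1
  b4 b8 (same2 _ _ f10 f11 (etrans b3 (esym b7))) off2).
rewrite (sum_coef _ _ f00 f01 f11 b2 b6 (same2 _ _ f00 f01 (etrans b1 (esym b5))) off2
  b5 b7 (same1 _ _ f01 f11 (etrans b6 (esym b8))) off1).
rewrite -mulrDr; case: (spec_match x y); last by rewrite addr0 mulr0.
have [_ _ _ ok] := ok_squareP face_ok.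
have sl (t : state) (z : basis e t) : size (loc z) = size (lT (LS t)) by rewrite size_map.
have LE (t : state) d1 d2 : t c1 = d1 -> t c2 = d2 -> LS t = mk_lstate marcs qs d1 d2.
  by rewrite /LS => -> ->.
move: ok (sl _ x) (sl _ y).
rewrite -(LE _ _ _ b1 b2) -(LE _ _ _ b3 b4) -(LE _ _ _ b5 b6) -(LE _ _ _ b7 b8).
move=> ok sx sy; rewrite ok ?mulr0 //.
case=> -[]; [rewrite -(LE _ _ _ b7 b8)|rewrite -(LE _ _ _ b3 b4)
            |rewrite -(LE _ _ _ b5 b6)|rewrite -(LE _ _ _ b1 b2)]; exact: one_proj_LS.
Qed.

End Face.

(** * The square of the total differential *)

Lemma upd_eq (w : seq slice) (s : state w) c b : upd s c b c = b.
Proof. by rewrite ffunE eqxx. Qed.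

Lemma upd_neq (w : seq slice) (s : state w) c b d : d != c -> upd s c b d = s d.
Proof. by move=> /negbTE dc; rewrite ffunE dc. Qed.

Lemma updC (w : seq slice) (s : state w) c d b b' : c != d ->
  upd (upd s c b) d b' = upd (upd s d b') c b.
Proof.
move=> cd; apply/ffunP => k; rewrite !ffunE.
by case: (eqVneq k d) => // ->; rewrite eq_sym (negbTE cd).
Qed.

Lemma grade_upd (w : seq slice) (s : state w) c : s c ->
  grade (upd s c false) = (grade s + 2)%R.
Proof.
move=> sc; rewrite /grade.
have -> : [set d | upd s c false d] = [set d | s d] :\ c.
  by apply/setP => d; rewrite !inE ffunE; case: eqP.
have -> : [set d | ~~ upd s c false d] = c |: [set d | ~~ s d].
  by apply/setP => d; rewrite !inE ffunE; case: eqP.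
have := cardsD1 c [set d | s d]; rewrite inE sc cardsU1 inE sc /=; lia.
Qed.

Section Square.
Variables (w : seq slice) (dir : pt -> bool).
Variables (e : state w -> seq (node w)) (o : state w -> pt -> bool).
Hypotheses (wfw : wf w) (dirP : orient_ok (link_edges w) dir).
Hypotheses (eP : forall s, enum_ok s (e s)) (oP : forall s, orient_ok (state_edges s) (o s)).
Variables (i : int) (f : Chain e) (s : state w) (y : basis e s).

(** Contribution of the path that starts at [s0], changes [d] first and then [c], and ends at
    [s]. *)
Definition through (c d : crossing w) (s0 : state w) : int :=
  (if grade s0 == i then \sum_(x : basis e s0) @f s0 x *
     \sum_(z : basis e (upd s c false)) coef dir o d x z * coef dir o c z y else 0)%R.

Definition face_term (c d : crossing w) : int :=
  (if s c && upd s c false d then through c d (upd (upd s c false) d false) else 0)%R.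

(** Exchanging [c] and [d] gives the other path around the same face. On the diagonal the term is 0,
    since a crossing reset to 0 cannot be reset again. *)
Lemma face_term_anti c d : (face_term c d = - face_term d c)%R.
Proof.
rewrite /face_term; case: (eqVneq c d) => [->|cd].
  by rewrite upd_eq andbF oppr0.
have dc : d != c by rewrite eq_sym.
rewrite !upd_neq // andbC; case: ifP => [/andP[sd sc]|_]; last by rewrite oppr0.
rewrite (updC s false false dc); apply/eqP; rewrite -addr_eq0 /through.
set s00 := upd (upd s c false) d false; case: ifP => _; last by rewrite addr0.
apply/eqP; rewrite -big_split /=; apply: big1 => x _; rewrite -mulrDr.
have famP (t : state w) : (forall k, k != d -> k != c -> t k = s k) -> fam d c s00 t.
  by move=> ts k kd kc; rewrite ts // /s00 !upd_neq.
have b1 : s00 d = false by rewrite upd_eq.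
have b2 : s00 c = false by rewrite upd_neq // upd_eq.
have b3 : upd s c false d = true by rewrite upd_neq.
have b6 : upd s d false c = true by rewrite upd_neq.
have fam00 : fam d c s00 s00 by [].
have fam10 : fam d c s00 (upd s c false) by apply: famP => k _; apply: upd_neq.
have fam01 : fam d c s00 (upd s d false) by apply: famP => k kd _; apply: upd_neq.
have fam11 : fam d c s00 s by apply: famP.
by rewrite (face_sum wfw oP dc eP dirP x y fam00 fam10 fam01 fam11 b1 b2 b3
  (upd_eq _ _ _) (upd_eq _ _ _) b6 sd sc) mulr0.
Qed.

Lemma dtot_dtot : (dtot dir o (i - 2) (dtot dir o i f) y = \sum_c \sum_d face_term c d)%R.
Proof.
rewrite /dtot big_mkcond; apply: eq_bigr => c _; rewrite /face_term.
case sc: (s c) => /=; last by rewrite big1.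
have -> : (\sum_d (if upd s c false d then through c d (upd (upd s c false) d false) else 0) =
   \sum_(x : basis e (upd s c false)) dtot dir o i f x * coef dir o c x y)%R.
  rewrite -big_mkcond; under [RHS]eq_bigr do rewrite /dtot mulr_suml.
  rewrite exchange_big; apply: eq_bigr => d _; rewrite /through.
  case: ifP => _; last by rewrite big1 // => x _; rewrite mul0r.
  under [LHS]eq_bigr do rewrite mulr_sumr; under [RHS]eq_bigr do rewrite mulr_suml.
  rewrite exchange_big; apply: eq_bigr => x _; apply: eq_bigr => z _.
  exact: mulrA.
(* Resetting a crossing raises the grade by 2, so if the intermediate state fails the outer grade
   test, no initial state has grade [i]. *)
case: eqP => // ng; apply/esym/big1 => x _; rewrite /dtot big1 ?mul0r // => d sd.
by case: eqP => // gi; case: ng; rewrite -gi (grade_upd sd) addrK.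
Qed.
End Square.

Theorem theorem1 (w : seq slice) (dir : pt -> bool)
    (e : state w -> seq (node w)) (o : state w -> pt -> bool) :
  wf w ->
  orient_ok (link_edges w) dir ->
  (forall s, enum_ok s (e s)) ->
  (forall s, orient_ok (state_edges s) (o s)) ->
  forall (i : int) (f : Chain e) (s : state w) (y : basis e s),
    @dtot w dir e o (i - 2)%R (@dtot w dir e o i f) s y = 0%R.
Proof.
move=> wfw dirP eP oP i f s y; rewrite dtot_dtot.
(* Exchanging the two summation indices negates the double sum, so it equals its own negative in the
   integers. *)
set S := (\sum_c _)%R; suff: (S = - S)%R by lia.
rewrite {1}/S exchange_big -sumrN; apply: eq_bigr => c _; rewrite -sumrN.
by apply: eq_bigr => d _; apply: face_term_anti.
Qed.
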